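(* Let $N\ge 1$, let $\Omega\subseteq\mathbb{R}^N$ be a nonempty (possibly unbounded) open set and let $p\in(2,2^* )$. Given $\mu>0$, let $u\in\mathcal{M}_\mu$ be a nondegenerate local minimum for the energy $E$ constrained to $\mathcal{M}_\mu$, and let $\lambda\in\mathbb{R}$ denote its frequency, i.e. the Lagrange multiplier such that $u$ is a weak solution of $\Delta u+|u|^{p-2}u=\lambda u$ in $\Omega$. Then $u$ is a nondegenerate local minimum for the action $J_\lambda$ on $\mathcal{N}_\lambda$.
   Context: Here $2^*=\frac{2N}{N-2}$ if $N\ge3$ and $2^*=+\infty$ if $N=1,2$; $\|\cdot\|_q$ is the norm of $L^q(\Omega)$; functions are real-valued. For $\lambda\in\mathbb{R}$ and $u\in H_0^1(\Omega)$, the action functional is $J_\lambda(u)=\frac12\|\nabla u\|_2^2+\frac\lambda2\|u\|_2^2-\frac1p\|u\|_p^p$ and the energy functional is $E(u)=\frac12\|\nabla u\|_2^2-\frac1p\|u\|_p^p$. The Nehari manifold is $\mathcal{N}_\lambda=\{u\in H_0^1(\Omega)\setminus\{0\}:\ \|\nabla u\|_2^2+\lambda\|u\|_2^2=\|u\|_p^p\}$; the mass-constrained manifold is $\mathcal{M}_\mu=\{u\in H_0^1(\Omega):\ \frac12\|u\|_2^2=\mu\}$. Weak solution means $\int_\Omega\nabla u\cdot\nabla w\,dx+\lambda\int_\Omega uw\,dx=\int_\Omega|u|^{p-2}uw\,dx$ for all $w\in H_0^1(\Omega)$. Let $\widetilde E$ be the restriction of $E$ to $\mathcal{M}_\mu$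 and $\widetilde J_\lambda$ the restriction of $J_\lambda$ to $\mathcal{N}_\lambda$. At such a $u$ (which is a critical point of both) the tangent spaces are $T_u\mathcal{M}_\mu=\{v\in H_0^1(\Omega):\int_\Omega uv\,dx=0\}$ and $T_u\mathcal{N}_\lambda=\{v\in H_0^1(\Omega):\int_\Omega|u|^{p-2}uv\,dx=0\}$. For $F=\widetilde E$ or $F=\widetilde J_\lambda$ and $v$ in the corresponding tangent space, $F''(u)v^2=\frac{d^2}{dt^2}F(\gamma(t))|_{t=0}$ for any smooth ($C^2$) curve $\gamma$ in the corresponding manifold with $\gamma(0)=u$, $\gamma'(0)=v$ (independent of the choice of $\gamma$ because $u$ is critical). A nondegenerate local minimum is a local minimizer $u$ (with respect to the $H^1_0(\Omega)$ topology on the manifold) for which the second derivative is uniformly positive on the tangent space, i.e. $\inf_{v\ne0}\frac{F''(u)v^2}{\|v\|_2^2}>0$, the infimum being over nonzero $v$ in the corresponding tangent space. *)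

(* Defs.v *)
From HB Require Import structures.
From mathcomp Require Import all_boot all_order all_algebra.
From mathcomp Require Import all_classical all_reals all_analysis.

Set Implicit Arguments.
Unset Strict Implicit.
Unset Printing Implicit Defensive.

Import Order.TTheory GRing.Theory Num.Theory.
Import numFieldNormedType.Exports.

Local Open Scope classical_set_scope.
Local Open Scope ring_scope.

(* 'rV[R]_n carries the sigma-algebra generated by the coordinates, which is
   the Borel one (as for n.-tuple R in the library). *)

Definition rV_display : measure_display -> measure_display.
Proof. exact. Qed.

Section measurable_rV.
Context {R : realType} (n : nat).

Let coord (i : 'I_n) (v : 'rV[R]_n) : R := v ord0 i.

Let rV_set0 : g_sigma_preimage coord set0.
Proof. exact: sigma_algebra0. Qed.

Let rV_setC A : g_sigma_preimage coord A -> g_sigma_preimage coord (~` A).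
Proof. exact: sigma_algebraC. Qed.

Let rV_bigcup (F : (set 'rV[R]_n)^nat) :
  (forall i, g_sigma_preimage coord (F i)) ->
  g_sigma_preimage coord (\bigcup_i (F i)).
Proof. exact: sigma_algebra_bigcup. Qed.

HB.instance Definition _ := @isMeasurable.Build (rV_display default_measure_display)
  'rV[R]_n (g_sigma_preimage coord) rV_set0 rV_setC rV_bigcup.

Lemma measurable_coord (i : 'I_n) :
  measurable_fun [set: 'rV[R]_n] (fun v : 'rV[R]_n => v ord0 i).
Proof.
move=> _ Y mY; rewrite setTI; apply: sub_sigma_algebra => /=.
rewrite -bigcup_seq/=; exists i => /=; first by rewrite mem_index_enum.
by exists Y => //; rewrite setTI.
Qed.

Lemma measurable_fun_rowP d (T : measurableType d) (f : T -> 'rV[R]_n) :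
  (forall i, measurable_fun setT (fun t => f t ord0 i)) ->
  measurable_fun setT f.
Proof.
move=> mf.
suff H : g_sigma_preimage (fun i => coord i \o f) `<=` measurable.
  move=> _ A mA; apply: H.
  rewrite (g_sigma_preimage_comp coord f).
  by exists A.
apply: smallest_sub; first exact: sigma_algebra_measurable.
rewrite -bigcup_seq; apply: bigcup_sub => i _.
by move=> A [B mB <-]; exact: mf.
Qed.

End measurable_rV.

Lemma sigma_finite_product d1 d2 (T1 : measurableType d1)
    (T2 : measurableType d2) (R : realType)
    (m1 : {sigma_finite_measure set T1 -> \bar R})
    (m2 : {sigma_finite_measure set T2 -> \bar R}) :
  sigma_finite setT (m1 \x m2)%E.
Proof.
have /sigma_finiteP[F [TF ndF Foo]] := sigma_finiteT m1.
have /sigma_finiteP[G [TG ndG Goo]] := sigma_finiteT m2.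
exists (fun n => F n `*` G n).
  rewrite -setXTT TF TG predeqE => -[x y]; split.
    move=> [/= [n _ Fnx] [k _ Gky]]; exists (maxn n k) => //; split.
    - by move: x Fnx; exact/subsetPset/ndF/leq_maxl.
    - by move: y Gky; exact/subsetPset/ndG/leq_maxr.
  by move=> [n _ []/= ? ?]; split; exists n.
move=> k; have [? ?] := Foo k; have [? ?] := Goo k.
split; first exact: measurableX.
by rewrite product_measure1E// lte_mul_pinfty// ge0_fin_numE.
Qed.

Section lebesgue_rV.
Context {R : realType}.

Definition consr n (xv : (measurableTypeR R * 'rV[R]_n)%type) : 'rV[R]_n.+1 :=
  \row_i (if unlift ord0 i is Some j then xv.2 ord0 j else xv.1).

Definition unconsr n (v : 'rV[R]_n.+1) :
    (measurableTypeR R * 'rV[R]_n)%type :=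
  (v ord0 ord0, \row_j v ord0 (lift ord0 j)).

Lemma consrE0 n (xv : measurableTypeR R * 'rV[R]_n) :
  consr xv ord0 ord0 = xv.1.
Proof. by rewrite mxE unlift_none. Qed.

Lemma consrES n (xv : measurableTypeR R * 'rV[R]_n) j :
  consr xv ord0 (lift ord0 j) = xv.2 ord0 j.
Proof. by rewrite mxE liftK. Qed.

Lemma consrK n : cancel (@consr n) (@unconsr n).
Proof.
move=> [x v]; rewrite /unconsr consrE0; congr pair.
by apply/rowP => j; rewrite mxE consrES.
Qed.

Lemma unconsrK n : cancel (@unconsr n) (@consr n).
Proof.
move=> v; apply/rowP => i.
case: (unliftP ord0 i) => [j ->|->]; first by rewrite consrES mxE.
by rewrite consrE0.
Qed.

Lemma measurable_consr n : measurable_fun setT (@consr n).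
Proof.
apply: measurable_fun_rowP => i.
case: (unliftP ord0 i) => [j ->|->].
- rewrite (_ : (fun t => _) =
      (fun v : 'rV[R]_n => v ord0 j) \o (@snd (measurableTypeR R) 'rV[R]_n)).
    by apply: measurableT_comp; [exact: measurable_coord|exact: measurable_snd].
  by apply/funext => t /=; rewrite consrES.
- rewrite (_ : (fun t => _) = @fst (measurableTypeR R) 'rV[R]_n).
    exact: measurable_fst.
  by apply/funext => t /=; rewrite consrE0.
Qed.

Lemma measurable_unconsr n : measurable_fun setT (@unconsr n).
Proof.
apply: measurable_fun_pair; first exact: measurable_coord.
apply: measurable_fun_rowP => i.
rewrite (_ : (fun t => _) = (fun v : 'rV[R]_n.+1 => v ord0 (lift ord0 i))).
  exact: measurable_coord.
by apply/funext => v; rewrite mxE.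
Qed.

Section step.
Variables (n : nat) (m : {sigma_finite_measure set 'rV[R]_n -> \bar R}).
Local Open Scope ereal_scope.

Definition mcons : set 'rV[R]_n.+1 -> \bar R :=
  pushforward (lebesgue_measure \x m) (@consr n).

Let mcons0 : mcons set0 = 0.
Proof. by rewrite /mcons /pushforward preimage_set0 measure0. Qed.

Let mcons_ge0 A : 0 <= mcons A.
Proof. by rewrite /mcons /pushforward; apply: measure_ge0. Qed.

Let mcons_sigma_additive : semi_sigma_additive mcons.
Proof.
move=> F mF tF mUF; rewrite /mcons /pushforward preimage_bigcup.
apply: measure_semi_sigma_additive.
- by move=> k; rewrite -[X in measurable X]setTI; exact: measurable_consr.
- apply/trivIsetP => i j _ _ ij; rewrite -preimage_setI.
  by move/trivIsetP : tF => /(_ _ _ _ _ ij) ->//; rewrite preimage_set0.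
- by rewrite -preimage_bigcup -[X in measurable X]setTI; exact: measurable_consr.
Qed.

HB.instance Definition _ := isMeasure.Build _ _ _ mcons
  mcons0 mcons_ge0 mcons_sigma_additive.

Let mcons_sigma_finite : sigma_finite setT mcons.
Proof.
have [F TF mF] := sigma_finite_product (@lebesgue_measure R) m.
exists (fun k => @unconsr n @^-1` F k).
  by rewrite -preimage_bigcup -TF preimage_setT.
move=> k; have [mFk Fk] := mF k; split.
  by rewrite -[X in measurable X]setTI; exact: measurable_unconsr.
rewrite /mcons /pushforward -comp_preimage (_ : _ \o _ = id) ?preimage_id//.
by apply/funext => x; exact: consrK.
Qed.

HB.instance Definition _ := @Measure_isSigmaFinite.Build _ _ _ mcons
  mcons_sigma_finite.
End step.

(* Lebesgue measure on R^n; see leb_box. *)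
Fixpoint leb n : {sigma_finite_measure set 'rV[R]_n -> \bar R} :=
  match n with
  | 0 => dirac (0 : 'rV[R]_0)
  | n'.+1 => mcons (leb n')
  end.

Lemma measurable_box n (A : 'I_n -> set (measurableTypeR R)) :
  (forall i, measurable (A i)) ->
  measurable [set v : 'rV[R]_n | forall i, A i (v ord0 i)].
Proof.
move=> mA; rewrite (_ : [set _ | _] =
    \bigcap_(i in [set: 'I_n]) ((fun v : 'rV[R]_n => v ord0 i) @^-1` A i)).
  apply: fin_bigcap_measurable => [|i _]; first exact: finite_finset.
  rewrite -[X in measurable X]setTI.
  exact: (@measurable_coord R n i measurableT _ (mA i)).
by apply/seteqP; split => [v vA i _|v vA i]; exact: vA.
Qed.

Lemma leb_box n (A : 'I_n -> set (measurableTypeR R)) :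
  (forall i, measurable (A i)) ->
  leb n [set v : 'rV[R]_n | forall i, A i (v ord0 i)]
    = (\prod_(i < n) lebesgue_measure (A i))%E.
Proof.
elim: n A => [A _|n IH A mA].
  by rewrite big_ord0 /= diracE mem_set// => -[].
rewrite big_ord_recl -IH; last by move=> i; exact: mA.
transitivity ((lebesgue_measure \x leb n)%E (A ord0 `*`
    [set v : 'rV[R]_n | forall i, A (lift ord0 i) (v ord0 i)])).
  rewrite /= /mcons /pushforward; congr (_ \x _)%E.
  apply/seteqP; split => [xv /= H|xv /= [H0 H] i].
    split; first by rewrite -consrE0.
    by move=> i; rewrite -consrES.
  by case: (unliftP ord0 i) => [j ->|->]; rewrite ?consrES ?consrE0.
rewrite (@product_measure1E _ _ (measurableTypeR R) _ _ lebesgue_measure)//.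
exact: (@measurable_box n (fun i => A (lift ord0 i)) (fun i => mA _)).
Qed.

End lebesgue_rV.

Section functions_on_open_sets.
Context {R : realType} {N : nat}.
Implicit Types (Omega : set 'rV[R]_N) (f : 'rV[R]_N -> R) (q : R).

Definition L2 Omega : set ('rV[R]_N -> R) :=
  [set f : 'rV[R]_N -> R | f \_ Omega \in Lfun (leb N) 2%:E].

(* The norm of L^q(Omega), and below the integral over Omega; both are 0 by
   default when the underlying extended-real value is infinite. *)
Definition normL Omega q f : R :=
  fine ('N[leb N]_(q%:E)[EFin \o (f \_ Omega)])%E.

Definition intO Omega f : R := (\int[leb N]_(x in Omega) f x)%R.

Definition partial (i : 'I_N) f : 'rV[R]_N -> R := 'D_(delta_mx ord0 i) f.

Definition gradient f : 'rV[R]_N -> 'rV[R]_N := fun x => \row_i partial i f x.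

Definition smooth f : Prop := forall s : seq 'I_N,
  continuous (foldr partial f s) /\
  forall i x, derivable (foldr partial f s) x (delta_mx ord0 i).

Definition Cc_infty Omega : set ('rV[R]_N -> R) :=
  [set f | [/\ smooth f, compact (closure [set x | f x != 0]) &
              closure [set x | f x != 0] `<=` Omega]].

Definition dotp (a b : 'rV[R]_N) : R := \sum_i a ord0 i * b ord0 i.

Definition weak_gradient Omega f (g : 'rV[R]_N -> 'rV[R]_N) : Prop :=
  forall (i : 'I_N) phi, Cc_infty Omega phi ->
    intO Omega (fun x => f x * partial i phi x) =
    - intO Omega (fun x => g x ord0 i * phi x).

End functions_on_open_sets.

(* An element of H^1(Omega) is given by a representative together with (a
   representative of) its weak gradient, which it determines almost everywhere.
   Representatives are total functions on R^N, but only their restrictions to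
   Omega matter. *)
Notation sobolev R N :=
  (('rV[R]_N -> R^o) * ('rV[R]_N -> 'rV[R]_N))%type.

Section sobolev_space.
Context {R : realType} {N : nat}.
Implicit Types (Omega : set 'rV[R]_N) (u v w : sobolev R N).

Definition H1 Omega : set (sobolev R N) :=
  [set u : sobolev R N | [/\ L2 Omega u.1, forall i, L2 Omega (fun x => u.2 x ord0 i) &
              weak_gradient Omega u.1 u.2]].

Definition normgrad Omega u : R :=
  normL Omega 2 (fun x => Num.sqrt (dotp (u.2 x) (u.2 x))).

Definition normH1 Omega u : R :=
  Num.sqrt (normL Omega 2 u.1 ^+ 2 + normgrad Omega u ^+ 2).

Definition H10 Omega : set (sobolev R N) :=
  [set u : sobolev R N | H1 Omega u /\ forall e : R, 0 < e -> exists phi,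
     Cc_infty Omega phi /\ normH1 Omega (u - (phi, gradient phi)) < e].

(* u <> 0 as an element of H^1, i.e. up to null sets. *)
Definition nonzero Omega u : Prop :=
  ~ {ae leb N, forall x, Omega x -> u.1 x = 0}.

(* gamma is a C^2 curve ]-e, e[ -> H^1_0(Omega) with derivatives gamma1 and
   gamma2; the values outside of ]-e, e[ are irrelevant. *)
Definition C2_curve Omega (e : R) (gamma gamma1 gamma2 : R -> sobolev R N) :=
  forall t : R, `|t| < e ->
  [/\ [/\ H10 Omega (gamma t), H10 Omega (gamma1 t) & H10 Omega (gamma2 t)],
      normH1 Omega (h^-1 *: (gamma (t + h) - gamma t) - gamma1 t)
        @[h --> 0^'] --> 0,
      normH1 Omega (h^-1 *: (gamma1 (t + h) - gamma1 t) - gamma2 t)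
        @[h --> 0^'] --> 0 &
      normH1 Omega (gamma2 s - gamma2 t) @[s --> t] --> 0].

Definition curve_through Omega (M : set (sobolev R N)) u v
    (gamma : R -> sobolev R N) : Prop :=
  exists e gamma1 gamma2,
  [/\ 0 < e, C2_curve Omega e gamma gamma1 gamma2,
      forall t : R, `|t| < e -> M (gamma t),
      gamma 0 = u & gamma1 0 = v].

Definition has_derive2 (f : R -> R) (t d : R) : Prop :=
  (\forall s \near t, derivable (f : R -> R^o) s 1) /\
  is_derive t 1 (derive1 (f : R -> R^o)) d.

(* F''(u) v^2 for F restricted to M: the common value of (F o gamma)''(0) over
   all C^2 curves gamma in M through u with velocity v. At a constrained
   critical point u and a tangent vector v such a value exists; the default 0
   only concerns other pairs. *)
Definition second_derivative Omega (M : set (sobolev R N))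
    (F : sobolev R N -> R) u v : R :=
  xget 0 [set d | (exists gamma, curve_through Omega M u v gamma) /\
    forall gamma, curve_through Omega M u v gamma ->
      has_derive2 (F \o gamma) 0 d].

Definition local_minimum Omega (M : set (sobolev R N)) (F : sobolev R N -> R) u :=
  M u /\ exists2 r : R, 0 < r &
    forall w, M w -> normH1 Omega (w - u) < r -> F u <= F w.

Definition nondegenerate_local_minimum Omega (M T : set (sobolev R N))
    (F : sobolev R N -> R) u : Prop :=
  local_minimum Omega M F u /\
  (0 < ereal_inf [set (second_derivative Omega M F u v
                        / normL Omega 2 v.1 ^+ 2)%:E
                 | v in T `&` nonzero Omega])%E.

Variable (Omega : set 'rV[R]_N) (p : R).

Definition energy u : R :=
  normgrad Omega u ^+ 2 / 2 - normL Omega p u.1 `^ p / p.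

Definition action (lambda : R) u : R :=
  normgrad Omega u ^+ 2 / 2 + lambda / 2 * normL Omega 2 u.1 ^+ 2
  - normL Omega p u.1 `^ p / p.

Definition mass_manifold (mu : R) : set (sobolev R N) :=
  [set u : sobolev R N | H10 Omega u /\ normL Omega 2 u.1 ^+ 2 / 2 = mu].

Definition nehari (lambda : R) : set (sobolev R N) :=
  [set u : sobolev R N | [/\ H10 Omega u, nonzero Omega u &
     normgrad Omega u ^+ 2 + lambda * normL Omega 2 u.1 ^+ 2
     = normL Omega p u.1 `^ p]].

Definition tangent_mass u : set (sobolev R N) :=
  [set v : sobolev R N | H10 Omega v /\ intO Omega (fun x => u.1 x * v.1 x) = 0].

Definition tangent_nehari u : set (sobolev R N) :=
  [set v : sobolev R N | H10 Omega v /\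
     intO Omega (fun x => `|u.1 x| `^ (p - 2) * u.1 x * v.1 x) = 0].

Definition weak_solution (lambda : R) u : Prop :=
  forall w, H10 Omega w ->
    intO Omega (fun x => dotp (u.2 x) (w.2 x))
    + lambda * intO Omega (fun x => u.1 x * w.1 x)
    = intO Omega (fun x => `|u.1 x| `^ (p - 2) * u.1 x * w.1 x).

End sobolev_space.

Definition critical_exponent (R : realType) (N : nat) : \bar R :=
  if (N <= 2)%N then +oo%E else ((2 * N)%:R / (N - 2)%:R)%:E.

(* Main.v *)
Require Import Defs.
From HB Require Import structures.
From mathcomp Require Import all_boot all_order all_algebra.
From mathcomp Require Import all_classical all_reals all_analysis.
From mathcomp Require Import measurable_realfun ring lra.

Set Implicit Arguments.
Unset Strict Implicit.
Unset Printing Implicit Defensive.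

Import Order.TTheory GRing.Theory Num.Theory.
Import numFieldNormedType.Exports.

Local Open Scope classical_set_scope.
Local Open Scope ring_scope.

(** Write P w for the integral of |w|^p over Omega and A w for the quadratic form
    |grad w|_2^2 + lambda |w|_2^2, so that J = A / 2 - P / p. On the mass manifold
    J and E differ by the constant lambda mu. The Nehari manifold is given by
    A = P; there J = (1/2 - 1/p) A, and this is the maximum of J on the ray
    through the point.

    Minimality. A point w of the Nehari manifold near u can be rescaled to a
    point c w of the mass manifold near u, and J u <= J (c w) <= J w, the first
    inequality by minimality of E and the second by maximality on the ray
    ([local_minimum_nehari]).

    Second derivatives. Rescaling also turns a curve gamma of the Nehari manifold
    through u into a curve rho gamma of the mass manifold ([normalized_curve]),
    along which J is (rho^2 / 2 - rho^p / p) A gamma. As rho = 1 is a critical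
    point of the factor, differentiating twice gives
      (J gamma)'' = (E (rho gamma))'' + (p - 2) rho'^2 A u     at t = 0
    ([nehari_second_derivative]). The velocity of rho gamma is v + rho' u, the
    projection w of the velocity v of gamma on the tangent space of the mass
    manifold, and rho' is determined by v. Hence the left-hand side depends on v
    only. It is at least c |w|_2^2 + (p - 2) rho'^2 A u with A u = P u > 0, hence
    at least a multiple of |v|_2^2 = |w|_2^2 + rho'^2 |u|_2^2.

    Regularity of P. The second derivative of J on the Nehari manifold is
    obtained without differentiating P along arbitrary curves, but one has to
    exhibit a curve of the Nehari manifold with a given velocity v, for which
    P (u + t v) must be finite and twice continuously differentiable. That it is
    finite is contained in the hypothesis: E is twice differentiable along the
    normalization of u + t w, which forces w to be in L^p ([Lfun_mass_part]),
    provided that u is in L^p. The latter follows from minimality by comparison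
    with test functions ([energy_minimum_powR_integral_gt0]). Differentiability is
    then differentiation under the integral sign ([C2on_integral_powR]).

    The comparison uses that test functions belong to H^1_0, that is, integration
    by parts ([integration_by_parts_Cc]); it comes down to the invariance of
    Lebesgue measure under translations. *)

(** * Lebesgue measure on R^n: Borel sets and translations *)

Section borel_rV.
Context {R : realType} {n : nat}.

(** An open set is the union of the boxes with rational vertices that it
    contains, and there are countably many of these. *)
Lemma open_measurable_rV (O : set 'rV[R]_n) : open O -> measurable O.
Proof.
move=> oO.
pose box (ab : 'rV[rat]_n * 'rV[rat]_n) := [set v : 'rV[R]_n |
  forall i, `]ratr (ab.1 ord0 i), ratr (ab.2 ord0 i)[%classic (v ord0 i)].
have -> : O = \bigcup_(ab in [set ab | box ab `<=` O]) box ab.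
  apply/seteqP; split => [x Ox|x [ab abO /abO]//].
  have /nbhs_ballP[e /= e0 xeO] : nbhs x O by exact: open_nbhs_nbhs.
  have lowr i : {q : rat | ratr q \in `]x ord0 i - e, x ord0 i[}.
    by apply/cid/rat_in_itvoo; rewrite ltrBlDr ltrDl.
  have uppr i : {q : rat | ratr q \in `]x ord0 i, x ord0 i + e[}.
    by apply/cid/rat_in_itvoo; rewrite ltrDl.
  exists (\row_i sval (lowr i), \row_i sval (uppr i)).
    move=> v /= vab; apply: xeO; rewrite /ball/=; split => //= i j.
    rewrite ord1; have /= := vab j; rewrite !mxE in_itv/=.
    case: (lowr j) (uppr j) => /= q1 + [/= q2]; rewrite !in_itv/=.
    move=> /andP[a1 a2] /andP[b1 b2] /andP[c1 c2].
    by rewrite /ball/= ltr_norml; apply/andP; split; lra.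
  move=> i /=; rewrite !mxE in_itv/=.
  case: (lowr i) (uppr i) => /= q1 + [/= q2]; rewrite !in_itv/=.
  by move=> /andP[_ ->] /andP[-> _].
have mbox ab : measurable (box ab).
  apply: (@measurable_box R n (fun i => `]ratr (ab.1 ord0 i), ratr (ab.2 ord0 i)[%classic)).
  by move=> i; exact: measurable_itv.
rewrite bigcup_mkcond.
apply: (@countable_bigcupT_measurable _ _ ('rV[rat]_n * 'rV[rat]_n)%type) => //.
by move=> ab; case: ifP.
Qed.

Lemma continuous_measurable_rV (f : 'rV[R]_n -> R) :
  continuous f -> measurable_fun setT f.
Proof.
move=> cf; apply: (measurability _ (RGenOpens.measurableE R)).
move=> _ [_ [a [b ->] <-]]; rewrite setTI; apply: open_measurable_rV.
by apply: open_comp => [x _|]; [exact: cf|exact: interval_open].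
Qed.

End borel_rV.

Section translation.
Context {R : realType}.

Lemma lebesgue_translate (a : R) (A : set (measurableTypeR R)) : measurable A ->
  lebesgue_measure ((fun x => x + a) @^-1` A) = lebesgue_measure A.
Proof.
have mt : measurable_fun [set: measurableTypeR R]
    ((fun x => x + a) : measurableTypeR R -> measurableTypeR R).
  exact: measurable_funD.
pose mt' := isMeasurableFun.Build _ _ _ _ _ mt.
pose t : {mfun measurableTypeR R >-> measurableTypeR R} :=
  HB.pack (fun x : measurableTypeR R => x + a) mt'.
move=> mA; symmetry.
apply: (@lebesgue_measure_unique R (pushforward lebesgue_measure t)) => //.
move=> _ [[b c] _ <-].
transitivity (@lebesgue_measure R (`]b - a, c - a]%classic)); last first.
  rewrite /pushforward; congr lebesgue_measure.
  by apply/seteqP; split => x /=; rewrite !in_itv/= ltrBlDr lerBrDr.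
rewrite !lebesgue_measure_itv/= !lte_fin ltrD2r.
by case: ifP => // _; rewrite -!EFinB; congr EFin; ring.
Qed.

Lemma measurable_translate n (a : 'rV[R]_n) :
  measurable_fun setT (fun x : 'rV[R]_n => x + a).
Proof.
apply: measurable_fun_rowP => i.
under eq_fun do rewrite mxE.
by apply: measurable_funD => //; exact: measurable_coord.
Qed.

(** By induction on the dimension: on R x R^n the translate of the product
    measure agrees with the product measure on rectangles. *)
Lemma leb_translate n (a : 'rV[R]_n) A : measurable A ->
  leb n ((fun x => x + a) @^-1` A) = leb n A.
Proof.
elim: n a A => [a A _|n IH a A mA].
  by congr (leb 0 _); apply/seteqP; split => x /=; rewrite (_ : x + a = x)//;
    apply/rowP => -[].
pose t (xv : measurableTypeR R * 'rV[R]_n) : measurableTypeR R * 'rV[R]_n :=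
  (xv.1 + (unconsr a).1, xv.2 + (unconsr a).2).
have mt : measurable_fun setT t.
  apply: measurable_fun_pair.
    exact: (@measurable_funD _ _ R setT fst (cst (unconsr a).1)).
  apply: (measurableT_comp (measurable_translate _)) => //.
pose mt' := isMeasurableFun.Build _ _ _ _ _ mt.
pose tt : {mfun (measurableTypeR R * 'rV[R]_n)%type >->
    (measurableTypeR R * 'rV[R]_n)%type} := HB.pack t mt'.
have mcA : measurable (@consr R n @^-1` A).
  by rewrite -[X in measurable X]setTI; exact: measurable_consr.
rewrite /= /mcons /pushforward.
transitivity (pushforward (lebesgue_measure \x leb n)%E tt (@consr R n @^-1` A)).
  rewrite /pushforward; congr ((lebesgue_measure \x leb n)%E _).
  apply/seteqP; suff E xv : consr xv + a = consr (t xv) by split => xv /=; rewrite E.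
  apply/rowP => i; rewrite mxE; case: (unliftP ord0 i) => [j ->|->].
    by rewrite !consrES /= !mxE.
  by rewrite !consrE0.
symmetry; apply: product_measure_unique => // B C mB mC.
transitivity ((lebesgue_measure \x leb n)%E
   (((fun x => x + (unconsr a).1) @^-1` B) `*` ((fun x => x + (unconsr a).2) @^-1` C))) => //.
have mB' : measurable ((fun x : measurableTypeR R => x + (unconsr a).1) @^-1` B).
  by rewrite -[X in measurable X]setTI; exact: measurable_funD.
have mC' : measurable ((fun x : 'rV[R]_n => x + (unconsr a).2) @^-1` C).
  by rewrite -[X in measurable X]setTI; exact: measurable_translate.
rewrite (product_measure1E _ _ mB' mC').
by congr (_ * _)%E; [exact: lebesgue_translate|exact: IH].
Qed.

Lemma integral_translate n (a : 'rV[R]_n) (f : 'rV[R]_n -> \bar R) :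
  measurable_fun setT f ->
  (\int[leb n]_x f (x + a)%R = \int[leb n]_x f x)%E.
Proof.
move=> mf.
have mt := @measurable_translate n a.
have ge0 (g : 'rV[R]_n -> \bar R) : measurable_fun setT g ->
    (forall x, 0 <= g x)%E -> (\int[leb n]_x g (x + a)%R = \int[leb n]_x g x)%E.
  move=> mg g0.
  have /= <- := ge0_integral_pushforward mt (leb n) measurableT mg (fun y _ => g0 y).
  by apply: eq_measure_integral => A mA _; exact: leb_translate.
rewrite [LHS]integralE [RHS]integralE; congr (_ - _)%E.
  under eq_integral do rewrite (funepos_comp f (fun x => x + a)).
  by apply: (ge0 (f^\+)%E) => //; exact/measurable_funepos.
under eq_integral do rewrite (funeneg_comp f (fun x => x + a)).
by apply: (ge0 (f^\-)%E) => //; exact/measurable_funeneg.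
Qed.

End translation.

(** * Integrals of partial derivatives *)

Section test_functions.
Context {R : realType} {N : nat}.
Implicit Types (f g phi psi : 'rV[R]_N -> R) (Omega : set 'rV[R]_N) (i : 'I_N).

Local Notation e_ i := (delta_mx ord0 i : 'rV[R]_N).

Definition cube (r : R) : set 'rV[R]_N := [set v | forall i, `[- r, r]%classic (v ord0 i)].

Lemma measurable_cube r : measurable (cube r).
Proof. by apply: (@measurable_box R N (fun=> `[- r, r]%classic)) => i; exact: measurable_itv. Qed.

Lemma leb_cube_lty r : (leb N (cube r) < +oo)%E.
Proof.
rewrite (@leb_box R N (fun=> `[- r, r]%classic)) => [|i]; last exact: measurable_itv.
rewrite ltey_eq; apply/orP; left; apply: prode_fin_num => i _.
by rewrite lebesgue_measure_itv/=; case: ifP.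
Qed.

(** What a test function and its partial derivatives have in common and what
    makes them integrable; it passes to sums, products and translates. *)
Definition cube_supported g : Prop := continuous g /\
  exists M r : R, forall x, `|g x| <= M /\ (g x != 0 -> cube r x).

Lemma cube_supported_measurable g : cube_supported g -> measurable_fun setT g.
Proof. by move=> [cg _]; exact: continuous_measurable_rV. Qed.

Lemma integrable_cube r (M : R) :
  (leb N).-integrable setT (EFin \o (fun x => M * \1_(cube r) x)).
Proof.
have mi : measurable_fun setT (EFin \o (fun x => M * \1_(cube r) x)).
  apply/measurable_EFinP/measurable_funM => //.
  by apply: measurable_indic; exact: measurable_cube.
apply/integrableP; split => //.
under eq_integral do rewrite /= normrM EFinM.
have mI : measurable_fun [set: 'rV[R]_N] (fun x => (`|\1_(cube r) x|)%:E : \bar R).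
  apply/measurable_EFinP/measurableT_comp => //.
  by apply: measurable_indic; exact: measurable_cube.
rewrite ge0_integralZl//.
under eq_integral do rewrite ger0_norm//.
rewrite (integral_indic _ measurableT (measurable_cube r)) setIT.
by rewrite lte_mul_pinfty ?lee_fin// leb_cube_lty.
Qed.

Lemma cube_supported_integrable g :
  cube_supported g -> (leb N).-integrable setT (EFin \o g).
Proof.
move=> csg; have mg := cube_supported_measurable csg.
have [_ [M [r H]]] := csg.
apply: le_integrable (integrable_cube r M) => //; first exact/measurable_EFinP.
move=> x _; have [gM gr] := H x; rewrite lee_fin.
have M0 : 0 <= M by rewrite (le_trans _ gM).
rewrite [leRHS]ger0_norm ?mulr_ge0// indicE.
have [->|gx0] := eqVneq (g x) 0; first by rewrite normr0 mulr_ge0.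
by rewrite mem_set ?mulr1//; exact: gr.
Qed.

Lemma cube_supportedM f g :
  cube_supported f -> cube_supported g -> cube_supported (fun x => f x * g x).
Proof.
move=> [cf [M [r H]]] [cg [M' [r' H']]]; split.
  by move=> x; exact: (continuousM (cf x) (cg x)).
exists (M * M'), r => x; have [fM fr] := H x; have [gM _] := H' x; split.
  by rewrite normrM ler_pM.
by rewrite mulf_eq0 negb_or => /andP[/fr].
Qed.

Lemma cube_supportedD f g :
  cube_supported f -> cube_supported g -> cube_supported (fun x => f x + g x).
Proof.
move=> [cf [M [r H]]] [cg [M' [r' H']]]; split.
  by move=> x; apply: (@continuousD _ R^o 'rV[R]_N _ _ x (cf x) (cg x)).
exists (M + M'), (Num.max r r') => x; have [m1 r1] := H x; have [m2 r2] := H' x.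
split; first by rewrite (le_trans (ler_normD _ _))// lerD.
have cubeS (s t : R) : s <= t -> cube s `<=` cube t.
  move=> st v vs j; have /= := vs j; rewrite !in_itv/= => /andP[h1 h2].
  by apply/andP; split; lra.
have [->|/r1] := eqVneq (f x) 0.
  by rewrite add0r => /r2; apply: cubeS; rewrite le_max lexx orbT.
by move=> + _; apply: cubeS; rewrite le_max lexx.
Qed.

Lemma cube_supported_norm_powR g (q : R) : 0 < q ->
  cube_supported g -> (leb N).-integrable setT (EFin \o (fun x => `|g x| `^ q)).
Proof.
move=> q0 csg; have mg := cube_supported_measurable csg.
have [_ [M [r H]]] := csg.
apply: le_integrable (integrable_cube r (M `^ q)) => //.
  apply/measurable_EFinP/(measurableT_comp (measurable_powR q)) => //.
  exact: measurableT_comp.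
move=> x _; have [gM gr] := H x; rewrite lee_fin.
have M0 : 0 <= M by rewrite (le_trans _ gM).
rewrite ger0_norm ?powR_ge0// ger0_norm ?mulr_ge0 ?powR_ge0// indicE.
have [->|gx0] := eqVneq (g x) 0.
  by rewrite normr0 powR0 ?gt_eqF// mulr_ge0 ?powR_ge0.
rewrite mem_set ?mulr1; last exact: gr.
by rewrite ge0_ler_powR ?nnegrE// ltW.
Qed.

Lemma cube_supported_translate g (c : 'rV[R]_N) :
  cube_supported g -> cube_supported (fun x => g (x + c)).
Proof.
move=> [cg [M [r H]]]; split.
  move=> x; apply: (@continuous_comp 'rV[R]_N 'rV[R]_N R (fun x => x + c) g _ _ (cg _)).
  by apply: (@continuousD _ 'rV[R]_N 'rV[R]_N id (cst c)); [exact: cvg_id|exact: cst_continuous].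
exists M, (r + `|c|) => x; have [gM gr] := H (x + c); split => // /gr xr i.
have /= := xr i; rewrite !in_itv/= !mxE => /andP[a b].
have : `|c ord0 i| <= `|c| by rewrite /Num.norm/= mx_normrE; apply: (le_bigmax _ _ (ord0, i)).
by rewrite ler_norml => /andP[d e]; apply/andP; split; lra.
Qed.

(** A directional derivative is an ordinary derivative along a line; this gives
    access to the one-variable theorem on differentiation under the integral
    sign. *)
Lemma line_is_derive g (v x : 'rV[R]_N) (h : R) : derivable g (x + h *: v) v ->
  is_derive (h : R^o) 1 (fun h : R^o => g (x + h *: v) : R^o) ('D_v g (x + h *: v)).
Proof.
move=> dg.
have E : (fun k : R => k^-1 *:
     (((fun h : R^o => g (x + h *: v) : R^o) \o shift h) (k *: 1) - g (x + h *: v)))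
   = (fun k : R => k^-1 *: ((g \o shift (x + h *: v)) (k *: v) - g (x + h *: v))).
  apply/funext => k /=; rewrite (_ : x + shift h (k *: 1) *: v = shift (x + h *: v) (k *: v))//.
  by rewrite /shift/= scalerDl [k *: 1]mulr1 addrCA.
by apply: DeriveDef; rewrite /derivable /derive ?E.
Qed.

(** The integral of x |-> g (x + h e_i) does not depend on h, because the
    measure is translation invariant; its derivative at h = 0 is the integral of
    the partial derivative. *)
Lemma integral_partial_eq0 i g : cube_supported g ->
  (forall x, derivable g x (e_ i)) -> cube_supported (partial i g) ->
  (\int[leb N]_x partial i g x)%R = 0.
Proof.
move=> csg dg csdg; have [_ [M [r H]]] := csdg.
have M0 : 0 <= M by have [+ _] := H 0; apply: le_trans.
pose f (h : R) x := g (x + h *: e_ i).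
have der h x := line_is_derive (dg (x + h *: e_ i)).
have d1f h x : partial1of2 f h x = partial i g (x + h *: e_ i).
  by rewrite partial1of2E; have /@derive_val := der h x.
(* For |h| < 1 the translates of a function supported in the cube of radius r
   are supported in the cube of radius r + 1. *)
pose G x := M * \1_(cube (r + 1)) x.
have dom h x : `]-1, 1[%classic h -> `|partial1of2 f h x| <= G x.
  rewrite /= in_itv/= => /andP[h1 h2].
  rewrite d1f /G indicE; have [gM gr] := H (x + h *: e_ i).
  have [->|/gr xr] := eqVneq (partial i g (x + h *: e_ i)) 0.
    by rewrite normr0 mulr_ge0.
  rewrite mem_set ?mulr1// => j; have /= := xr j; rewrite !in_itv/= !mxE eqxx/=.
  by case: (_ == _) => /=; rewrite ?mulr1 ?mulr0 => /andP[a b]; apply/andP; split; lra.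
have I0 : `]-1, 1[%classic (0 : R) by rewrite /= in_itv/= ltrN10 ltr01.
have intf h : `]-1, 1[%classic h -> (leb N).-integrable setT (EFin \o f h).
  by move=> _; apply/cube_supported_integrable/cube_supported_translate.
have derf h x : `]-1, 1[%classic h -> setT x -> derivable (f^~ x) h 1.
  by move=> _ _; have /@ex_derive := der h x.
have G0 x : 0 <= G x by rewrite mulr_ge0.
have := @differentiation_under_integral R _ _ (leb N) f setT measurableT 0 (-1) 1
  I0 intf derf G G0 (integrable_cube _ _) (fun h x hI _ => dom h x hI).
have -> : (fun x' : R => (\int[leb N]_y f x' y)%R) = cst (\int[leb N]_y g y)%R.
  apply/funext => h; rewrite /Rintegral /f; congr fine.
  rewrite (integral_translate (h *: e_ i) (f := EFin \o g))//.
  by apply/measurable_EFinP; exact: cube_supported_measurable.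
rewrite derive1_cst => ->; apply: eq_Rintegral => x _.
by rewrite d1f scale0r addr0.
Qed.

End test_functions.

(** * Test functions *)

Section smooth_functions.
Context {R : realType} {N : nat}.
Implicit Types (f g h phi psi : 'rV[R]_N -> R) (Omega : set 'rV[R]_N) (i : 'I_N).

Local Notation e_ i := (delta_mx ord0 i : 'rV[R]_N).
Local Notation supp f := (closure [set x | f x != 0]).

Lemma compact_cube_supported (K : set 'rV[R]_N) h : compact K -> continuous h ->
  (forall x, h x != 0 -> K x) -> cube_supported h.
Proof.
move=> cK ch hK; split => //.
have [r [_ /(_ (r + 1))]] := compact_bounded cK.
rewrite ltrDl ltr01 => /(_ isT) Kr.
have /compact_bounded[M [_ /(_ (M + 1))]] : compact (h @` K).
  by apply: continuous_compact => //; exact: continuous_subspaceT.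
rewrite ltrDl ltr01 => /(_ isT) hM.
exists (`|M + 1|), (r + 1) => x; split => [|/hK /Kr xr i].
  have [->|/hK Kx] := eqVneq (h x) 0; first by rewrite normr0.
  by apply: le_trans (ler_norm _); apply: hM; exists x.
rewrite /= in_itv/= -ler_norml; apply: le_trans xr.
by rewrite /Num.norm/= mx_normrE; apply: (le_bigmax _ _ (ord0, i)).
Qed.

Lemma partial_supp i f x : partial i f x != 0 -> supp f x.
Proof.
move=> fx; apply: contrapT => nx; move/eqP: fx; apply; rewrite /partial.
have xU : \forall y \near x, f y = cst 0 y.
  have oU : open (~` supp f) by apply: closed_openC; exact: closed_closure.
  have := open_nbhs_nbhs (conj oU nx); apply: filterS => y ny.
  by apply/eqP/negPn/negP => fy; apply: ny; exact: subset_closure.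
by rewrite (near_eq_derive _ xU) derive_cst.
Qed.

Lemma Cc_infty_cube_supported Omega phi : Cc_infty Omega phi ->
  cube_supported phi /\ forall i, cube_supported (partial i phi).
Proof.
move=> [sphi cphi _]; split => [|i]; apply: (compact_cube_supported cphi).
- by have [] := sphi [::].
- by move=> x px; exact: subset_closure.
- by have [] := sphi [:: i].
- by move=> x; exact: partial_supp.
Qed.

Lemma Cc_infty_derivable Omega phi i x : Cc_infty Omega phi ->
  derivable phi x (e_ i).
Proof. by move=> [sphi _ _]; have [_] := sphi [::]; exact. Qed.

Lemma Cc_infty_restrict Omega phi : Cc_infty Omega phi -> phi \_ Omega = phi.
Proof.
move=> [_ _ sO]; apply/funext => x; rewrite patchE; case: ifPn => // /negP xO.
apply/eqP; rewrite eq_sym; apply/negPn/negP => px; apply/xO/mem_set/sO.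
exact: subset_closure.
Qed.

Lemma Cc_infty_partial_restrict Omega phi i : Cc_infty Omega phi ->
  partial i phi \_ Omega = partial i phi.
Proof.
move=> [_ _ sO]; apply/funext => x; rewrite patchE; case: ifPn => // /negP xO.
apply/eqP; rewrite eq_sym; apply/negPn/negP => px; apply/xO/mem_set/sO.
exact: partial_supp px.
Qed.

Lemma partial_linear i (a : R) f g x : derivable f x (e_ i) -> derivable g x (e_ i) ->
  derivable (fun x => a * f x + g x) x (e_ i) /\
  partial i (fun x => a * f x + g x) x = a * partial i f x + partial i g x.
Proof.
move=> df dg; have daf : derivable (a \*: f) x (e_ i) by exact: derivableZ.
split; first by have := derivableD daf dg.
by rewrite /partial; have := deriveD daf dg; rewrite deriveZ.
Qed.

Lemma foldr_partial_linear (a : R) f g : smooth f -> smooth g -> forall s,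
  foldr partial (fun x => a * f x + g x) s =
  (fun x => a * foldr partial f s x + foldr partial g s x).
Proof.
move=> sf sg; elim=> // i s /= ->; apply/funext => x.
by have [] := partial_linear a ((sf s).2 i x) ((sg s).2 i x).
Qed.

Lemma Cc_infty_linear Omega (a : R) phi psi : Cc_infty Omega phi -> Cc_infty Omega psi ->
  Cc_infty Omega (fun x => a * phi x + psi x).
Proof.
move=> [sf cf fO] [sg cg gO].
have sub : supp (fun x => a * phi x + psi x) `<=` supp phi `|` supp psi.
  rewrite -closureU; apply: closure_subset => x /= h.
  have [fx|] := eqVneq (phi x) 0; last by left.
  by right; move: h; rewrite fx mulr0 add0r.
split.
- move=> s; rewrite foldr_partial_linear//.
  have [cfs dfs] := sf s; have [cgs dgs] := sg s; split.
    move=> x; apply: (@continuousD _ R^o 'rV[R]_N (fun x => a * foldr partial phi s x));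
      last exact: cgs.
    by apply: (@continuousM _ _ (cst a) (foldr partial phi s)); [exact: cst_continuous|exact: cfs].
  by move=> i x; have [] := partial_linear a (dfs i x) (dgs i x).
- apply: subclosed_compact (compactU cf cg) sub; exact: closed_closure.
- by apply: subset_trans sub _ => x [/fO|/gO].
Qed.

Lemma gradient_linear Omega (a : R) phi psi :
  Cc_infty Omega phi -> Cc_infty Omega psi ->
  gradient (fun x => a * phi x + psi x) = a *: gradient phi + gradient psi.
Proof.
move=> cphi cpsi; apply/funext => x; apply/rowP => i; rewrite !mxE.
by have [] := partial_linear a (@Cc_infty_derivable _ _ i x cphi)
  (@Cc_infty_derivable _ _ i x cpsi).
Qed.

(** The integral of a partial derivative of phi psi vanishes. *)
Lemma integration_by_parts_Cc Omega phi psi i : Cc_infty Omega phi -> Cc_infty Omega psi ->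
  intO Omega (fun x => phi x * partial i psi x) =
  - intO Omega (fun x => partial i phi x * psi x).
Proof.
move=> cphi cpsi.
have [sphi sdphi] := Cc_infty_cube_supported cphi.
have [spsi sdpsi] := Cc_infty_cube_supported cpsi.
have dM x : derivable (phi * psi) x (e_ i).
  by apply: derivableM; [exact: Cc_infty_derivable cphi|exact: Cc_infty_derivable cpsi].
have pM : partial i (phi * psi) = (fun x => phi x * partial i psi x + partial i phi x * psi x).
  apply/funext => x; rewrite /partial deriveM; first last.
  - exact: Cc_infty_derivable cpsi.
  - exact: Cc_infty_derivable cphi.
  by congr (_ + _); rewrite mulrC.
have sM1 := cube_supportedM sphi (sdpsi i).
have sM2 := cube_supportedM (sdphi i) spsi.
have : (\int[leb N]_x partial i (phi * psi) x)%R = 0.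
  apply: integral_partial_eq0 => //; first exact: cube_supportedM.
  by rewrite pM; exact: cube_supportedD.
rewrite pM RintegralD//; try exact: cube_supported_integrable.
move/eqP; rewrite addr_eq0 => /eqP.
rewrite /intO [in X in _ -> X]Rintegral_mkcond [in X in _ -> _ = - X]Rintegral_mkcond.
have rE f g : g \_ Omega = g -> (fun x => f x * g x) \_ Omega = (fun x => f x * g x).
  move=> E; apply/funext => x; rewrite patchE; case: ifPn => // xO.
  by rewrite -E patchE (negbTE xO) mulr0.
rewrite !rE//; first exact: Cc_infty_restrict.
exact: Cc_infty_partial_restrict.
Qed.

Lemma cube_supported_Lfun f (q : R) : 1 <= q -> cube_supported f -> f \in Lfun (leb N) q%:E.
Proof.
move=> q1 sf; have q0 : 0 < q by rewrite (lt_le_trans ltr01).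
rewrite inE; apply/andP; split; first by rewrite inE/=; exact: cube_supported_measurable.
rewrite inE/= /finite_norm unlock poweR_lty//.
have /integrableP[_] := cube_supported_norm_powR q0 sf; apply: le_lt_trans.
by under [leRHS]eq_integral => x _ do rewrite /= ger0_norm ?powR_ge0//.
Qed.

End smooth_functions.

(** * Integrals over an open set and the forms of H^1 *)

Section L2_space.
Context {R : realType} {N : nat}.
Variable Omega : set 'rV[R]_N.
Implicit Types (f g h : 'rV[R]_N -> R).

(** This holds for every f: when the integral is infinite, both sides take the
    default value 0. *)
Lemma normL_powR (q : R) f : q != 0 ->
  normL Omega q f `^ q = intO Omega (fun x => `|f x| `^ q).
Proof.
move=> q0; rewrite /intO Rintegral_mkcond /Rintegral /normL.
have E : (\int[leb N]_x (((fun x => `|f x| `^ q) \_ Omega) x)%:E =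
    'N[leb N]_q%:E[EFin \o f \_ Omega] `^ q)%E.
  rewrite poweR_Lnorm//; apply: eq_integral => x _ /=.
  by rewrite !patchE; case: ifPn => //=; rewrite normr0 powR0.
rewrite E; have := @Lnorm_ge0 _ _ _ (leb N) q%:E (EFin \o f \_ Omega).
by case: ('N[leb N]_q%:E[EFin \o f \_ Omega])%E => [r||]//= _; rewrite (negbTE q0) powR0.
Qed.

Lemma normL2_sqr f : normL Omega 2 f ^+ 2 = intO Omega (fun x => f x ^+ 2).
Proof.
rewrite -powR_mulrn ?normL_powR ?pnatr_eq0//; last first.
  by rewrite fine_ge0// Lnorm_ge0.
congr (Rintegral _ _ _); apply/funext => x.
by rewrite powR_mulrn// real_normK// num_real.
Qed.

Definition integrableO f := (leb N).-integrable setT (EFin \o (f \_ Omega)).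

Lemma intOE f : intO Omega f = (\int[leb N]_x (f \_ Omega) x)%R.
Proof. exact: Rintegral_mkcond. Qed.

Lemma intOD f g : integrableO f -> integrableO g ->
  intO Omega (fun x => f x + g x) = intO Omega f + intO Omega g.
Proof.
move=> If Ig; rewrite !intOE -RintegralD//.
congr (Rintegral _ _ _); apply/funext => x /=.
by rewrite !patchE; case: ifP => //; rewrite addr0.
Qed.

Lemma intOZ a f : integrableO f ->
  intO Omega (fun x => a * f x) = a * intO Omega f.
Proof.
move=> If; rewrite !intOE -RintegralZl//.
congr (Rintegral _ _ _); apply/funext => x /=.
by rewrite !patchE; case: ifP => //; rewrite mulr0.
Qed.

Lemma intO_ge0 f : (forall x, 0 <= f x) -> 0 <= intO Omega f.
Proof. by move=> f0; apply: Rintegral_ge0 => x _; exact: f0. Qed.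

Lemma le_intO f g : integrableO f -> integrableO g ->
  (forall x, f x <= g x) -> intO Omega f <= intO Omega g.
Proof.
move=> If Ig fg; rewrite !intOE; apply: le_Rintegral => // x _.
by rewrite !patchE; case: ifP.
Qed.

Lemma eq_intO f g : (forall x, f x = g x) -> intO Omega f = intO Omega g.
Proof. by move=> fg; congr (Rintegral _ _ _); apply/funext. Qed.

Lemma integrableOD f g : integrableO f -> integrableO g ->
  integrableO (fun x => f x + g x).
Proof.
move=> If Ig; have := integrableD measurableT If Ig.
rewrite /integrableO; congr (integrable _ _ _); apply/funext => x /=.
by rewrite !patchE; case: ifP => //; rewrite ?adde0 // EFinD.
Qed.

Lemma integrableOZ a f : integrableO f -> integrableO (fun x => a * f x).
Proof.
move=> If; have := @integrableZl _ _ _ (leb N) _ measurableT a _ If.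
rewrite /integrableO; congr (integrable _ _ _); apply/funext => x /=.
by rewrite !patchE; case: ifP => //; rewrite -EFinM// mulr0.
Qed.

Lemma Lfun_linear (q : R) a f g : 1 <= q ->
  f \_ Omega \in Lfun (leb N) q%:E -> g \_ Omega \in Lfun (leb N) q%:E ->
  (fun x => a * f x + g x) \_ Omega \in Lfun (leb N) q%:E.
Proof.
move=> q1 f2 g2; have q1' : (1 <= q%:E)%E by rewrite lee_fin.
rewrite (_ : _ \_ _ = a *: (f \_ Omega) + (g \_ Omega)).
  exact: (Lfun_submod_closed (leb N) q1').2.
apply/funext => x /=; rewrite !fctE !patchE; case: ifP => // _.
by rewrite scaler0 addr0.
Qed.

Lemma L2_linear a f g : L2 Omega f -> L2 Omega g -> L2 Omega (fun x => a * f x + g x).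
Proof. by apply: Lfun_linear; rewrite ler1n. Qed.

Lemma L2_mul_integrable f g : L2 Omega f -> L2 Omega g ->
  integrableO (fun x => f x * g x).
Proof.
move=> f2 g2; have /Lfun1_integrable := Lfun2_mul_Lfun1 f2 g2.
rewrite /integrableO; congr (integrable _ _ _); apply/funext => x /=.
by rewrite !patchE; case: ifP => // _; rewrite mulr0.
Qed.

End L2_space.

Section H1_space.
Context {R : realType} {N : nat}.
Variable Omega : set 'rV[R]_N.
Implicit Types (u v w : sobolev R N).

(** The two parts of the scalar product of H^1. They are kept apart because the
    energy and the action weigh them differently. *)
Definition dotL2 u v := intO Omega (fun x => u.1 x * v.1 x).
Definition dotgrad u v := intO Omega (fun x => dotp (u.2 x) (v.2 x)).

Lemma normL2E u : normL Omega 2 u.1 ^+ 2 = dotL2 u u.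
Proof. by rewrite normL2_sqr; apply: eq_intO => x; rewrite expr2. Qed.

Lemma dotp_ge0 (a : 'rV[R]_N) : 0 <= dotp a a.
Proof. by apply: sumr_ge0 => i _; rewrite -expr2 sqr_ge0. Qed.

Lemma normgradE u : normgrad Omega u ^+ 2 = dotgrad u u.
Proof. by rewrite normL2_sqr; apply: eq_intO => x; rewrite sqr_sqrtr// dotp_ge0. Qed.

Lemma normH1E u : normH1 Omega u = Num.sqrt (dotL2 u u + dotgrad u u).
Proof. by rewrite /normH1 normL2E normgradE. Qed.

Lemma dotpC (a b : 'rV[R]_N) : dotp a b = dotp b a.
Proof. by apply: eq_bigr => i _; rewrite mulrC. Qed.

Lemma dotp_linearl (c : R) (a b d : 'rV[R]_N) : dotp (c *: a + b) d = c * dotp a d + dotp b d.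
Proof.
by rewrite /dotp mulr_sumr -big_split; apply: eq_bigr => i _; rewrite !mxE mulrDl mulrA.
Qed.

Lemma integrableO_dotp u v : H1 Omega u -> H1 Omega v ->
  integrableO Omega (fun x => dotp (u.2 x) (v.2 x)).
Proof.
move=> [_ u2 _] [_ v2 _]; rewrite /dotp.
elim: (index_enum 'I_N) => [|i s IHs].
  under eq_fun do rewrite big_nil.
  rewrite /integrableO (_ : EFin \o _ = (cst 0)%E); first exact: integrable0.
  by apply/funext => x /=; rewrite patchE; case: ifP.
under eq_fun do rewrite big_cons.
by apply: integrableOD => //; exact: L2_mul_integrable.
Qed.

Lemma dotL2C u v : dotL2 u v = dotL2 v u.
Proof. by apply: eq_intO => x; rewrite mulrC. Qed.

Lemma dotgradC u v : dotgrad u v = dotgrad v u.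
Proof. by apply: eq_intO => x; rewrite dotpC. Qed.

Lemma dotL2_ge0 u : 0 <= dotL2 u u.
Proof. by apply: intO_ge0 => x; rewrite -expr2 sqr_ge0. Qed.

Lemma dotgrad_ge0 u : 0 <= dotgrad u u.
Proof. by apply: intO_ge0 => x; exact: dotp_ge0. Qed.

Lemma dotL2_linearl (c : R) u v w : H1 Omega u -> H1 Omega v -> H1 Omega w ->
  dotL2 (c *: u + v) w = c * dotL2 u w + dotL2 v w.
Proof.
move=> [u1 _ _] [v1 _ _] [w1 _ _]; rewrite /dotL2 -intOZ; last exact: L2_mul_integrable.
rewrite -intOD; last exact: L2_mul_integrable.
  by apply: eq_intO => x /=; rewrite !fctE mulrDl -mulrA.
by apply: integrableOZ; exact: L2_mul_integrable.
Qed.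

Lemma dotgrad_linearl (c : R) u v w : H1 Omega u -> H1 Omega v -> H1 Omega w ->
  dotgrad (c *: u + v) w = c * dotgrad u w + dotgrad v w.
Proof.
move=> u1 v1 w1; rewrite /dotgrad -intOZ; last exact: integrableO_dotp.
rewrite -intOD; last exact: integrableO_dotp.
  by apply: eq_intO => x /=; rewrite !fctE dotp_linearl.
by apply: integrableOZ; exact: integrableO_dotp.
Qed.

Lemma Cc_infty_L2 phi : Cc_infty Omega phi ->
  L2 Omega phi /\ forall i, L2 Omega (partial i phi).
Proof.
move=> cphi; have [sphi dphi] := Cc_infty_cube_supported cphi; split => [|i].
  rewrite /L2/= (Cc_infty_restrict cphi); apply: cube_supported_Lfun sphi.
  by rewrite ler1n.
rewrite /L2/= (Cc_infty_partial_restrict i cphi); apply: cube_supported_Lfun (dphi i).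
by rewrite ler1n.
Qed.

Lemma H1_linear (c : R) u v : H1 Omega u -> H1 Omega v -> H1 Omega (c *: u + v).
Proof.
move=> [u1 u2 wu] [v1 v2 wv]; split.
- exact: (L2_linear c u1 v1).
- move=> i; have := L2_linear c (u2 i) (v2 i).
  by congr (L2 _ _); apply/funext => x /=; rewrite !fctE !mxE.
- move=> i phi cphi; have [p1 p2] := Cc_infty_L2 cphi.
  transitivity (c * intO Omega (fun x => u.1 x * partial i phi x)
      + intO Omega (fun x => v.1 x * partial i phi x)).
    rewrite -intOZ; last exact: L2_mul_integrable.
    rewrite -intOD; last exact: L2_mul_integrable.
      by apply: eq_intO => x /=; rewrite !fctE mulrDl -mulrA.
    by apply: integrableOZ; exact: L2_mul_integrable.
  rewrite wu// wv// mulrN -opprD; congr (- _).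
  rewrite -intOZ; last exact: (L2_mul_integrable (u2 i)).
  rewrite -intOD; last exact: (L2_mul_integrable (v2 i)).
    by apply: eq_intO => x /=; rewrite !fctE !mxE mulrDl -mulrA.
  by apply: integrableOZ; exact: (L2_mul_integrable (u2 i)).
Qed.

(** The classical gradient of a test function is its weak gradient. *)
Lemma Cc_infty_H1 phi : Cc_infty Omega phi -> H1 Omega (phi, gradient phi).
Proof.
move=> cphi; have [p1 p2] := Cc_infty_L2 cphi; split => //=.
  move=> i; have := p2 i.
  by congr (L2 _ _); apply/funext => x /=; rewrite mxE.
move=> i psi cpsi; rewrite (integration_by_parts_Cc i cphi cpsi).
by congr (- _); apply: eq_intO => x; rewrite mxE.
Qed.

End H1_space.

(** * Seminormed subspaces *)

Section semi_inner_product.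
Context {R : realType} {V : lmodType R}.
Implicit Types (S : set V) (B C : V -> V -> R).

(** [B] is a positive semidefinite symmetric form on the subspace [S]. It is
    defined on the whole of [V], but it is bilinear only on [S], as the scalar
    product of H^1 is on pairs of arbitrary functions. Positivity is asked
    everywhere because integrals of nonnegative functions are nonnegative even
    when they take a default value. *)
Record semi_inner S B : Prop := SemiInner {
  semi_inner0 : S 0 ;
  semi_inner_closed : forall c u v, S u -> S v -> S (c *: u + v) ;
  semi_innerC : forall u v, B u v = B v u ;
  semi_inner_linearl : forall c u v w, S u -> S v -> S w ->
    B (c *: u + v) w = c * B u w + B v w ;
  semi_inner_ge0 : forall u, 0 <= B u u }.

Definition snorm B u : R := Num.sqrt (B u u).

Variables (S : set V) (B : V -> V -> R).
Hypothesis SB : semi_inner S B.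

Lemma subspaceD u v : S u -> S v -> S (u + v).
Proof. by move=> Su Sv; rewrite -[u]scale1r; exact: semi_inner_closed SB 1 _ _ Su Sv. Qed.

Lemma subspaceZ c u : S u -> S (c *: u).
Proof.
move=> Su; rewrite -[_ *: _]addr0; apply: (semi_inner_closed SB) => //.
exact: semi_inner0 SB.
Qed.

Lemma subspaceB u v : S u -> S v -> S (u - v).
Proof. by move=> Su Sv; rewrite -scaleN1r; apply: subspaceD => //; exact: subspaceZ. Qed.

Lemma innerDl u v w : S u -> S v -> S w -> B (u + v) w = B u w + B v w.
Proof. by move=> Su Sv Sw; rewrite -[u]scale1r (semi_inner_linearl SB)// !(mul1r, scale1r). Qed.

Lemma inner0l w : S w -> B 0 w = 0.
Proof.
move=> Sw; have := innerDl (semi_inner0 SB) (semi_inner0 SB) Sw.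
by rewrite addr0 => /eqP; rewrite -subr_eq subrr => /eqP.
Qed.

Lemma innerZl c u w : S u -> S w -> B (c *: u) w = c * B u w.
Proof.
move=> Su Sw; have S0 := semi_inner0 SB.
by rewrite -[c *: u]addr0 (semi_inner_linearl SB)// inner0l// addr0.
Qed.

Lemma innerBl u v w : S u -> S v -> S w -> B (u - v) w = B u w - B v w.
Proof.
move=> Su Sv Sw; rewrite -scaleN1r innerDl//; last exact: subspaceZ.
by rewrite innerZl// mulN1r.
Qed.

Lemma innerDr u v w : S u -> S v -> S w -> B w (u + v) = B w u + B w v.
Proof. by move=> Su Sv Sw; rewrite (semi_innerC SB) innerDl// !(semi_innerC SB w). Qed.

Lemma innerZr c u w : S u -> S w -> B w (c *: u) = c * B w u.
Proof. by move=> Su Sw; rewrite (semi_innerC SB) innerZl// !(semi_innerC SB w). Qed.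

Lemma innerBr u v w : S u -> S v -> S w -> B w (u - v) = B w u - B w v.
Proof. by move=> Su Sv Sw; rewrite (semi_innerC SB) innerBl// !(semi_innerC SB w). Qed.

Lemma inner_sqrD u v : S u -> S v -> B (u + v) (u + v) = B u u + 2 * B u v + B v v.
Proof.
move=> Su Sv; have Suv := subspaceD Su Sv.
rewrite innerDl// !innerDr// (semi_innerC SB v u); ring.
Qed.

Lemma inner_sqrZ c u : S u -> B (c *: u) (c *: u) = c ^+ 2 * B u u.
Proof.
move=> Su; have Scu := subspaceZ c Su.
by rewrite innerZl// innerZr// expr2 mulrA.
Qed.

Lemma Cauchy_Schwarz u v : S u -> S v -> B u v ^+ 2 <= B u u * B v v.
Proof.
move=> Su Sv.
have H c : 0 <= c ^+ 2 * B u u + 2 * c * B u v + B v v.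
  have := semi_inner_ge0 SB (c *: u + v).
  rewrite inner_sqrD//; last exact: subspaceZ.
  rewrite innerZl//; last exact: subspaceZ.
  rewrite innerZr// innerZl// => /le_trans; apply.
  by rewrite -subr_ge0 le_eqVlt; apply/orP; left; apply/eqP; ring.
have Bu := semi_inner_ge0 SB u; have Bv := semi_inner_ge0 SB v.
have [Bu0|Bu0] := eqVneq (B u u) 0.
  (* The form is affine in c along c u + v and bounded below, hence constant:
     otherwise it would take the value -1 at the c below. *)
  have [->|Buv0] := eqVneq (B u v) 0; first by rewrite expr0n/= mulr_ge0.
  have := H (- (B v v + 1) / (2 * B u v)); rewrite Bu0 mulr0 add0r.
  have -> : 2 * (- (B v v + 1) / (2 * B u v)) * B u v = - (B v v + 1).
    by field.
  by move=> h; exfalso; lra.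
have {}Bu0 : 0 < B u u by rewrite lt_neqAle eq_sym Bu0.
(* The minimizer of the quadratic polynomial in c. *)
have := H (- B u v / B u u).
have -> : (- B u v / B u u) ^+ 2 * B u u + 2 * (- B u v / B u u) * B u v + B v v
   = (B u u * B v v - B u v ^+ 2) / B u u by field; rewrite gt_eqF.
by rewrite pmulr_lge0 ?invr_gt0// subr_ge0.
Qed.

Lemma normr_inner_le u v : S u -> S v -> `|B u v| <= snorm B u * snorm B v.
Proof.
move=> Su Sv; rewrite /snorm -sqrtrM ?(semi_inner_ge0 SB)// -sqrtr_sqr ler_wsqrtr//.
exact: Cauchy_Schwarz.
Qed.

Lemma snorm_ge0 u : 0 <= snorm B u.
Proof. exact: sqrtr_ge0. Qed.

Lemma snorm_sqr u : snorm B u ^+ 2 = B u u.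
Proof. by rewrite sqr_sqrtr// (semi_inner_ge0 SB). Qed.

Lemma snormD u v : S u -> S v -> snorm B (u + v) <= snorm B u + snorm B v.
Proof.
move=> Su Sv; rewrite -(@ler_pXn2r _ 2)// ?nnegrE ?addr_ge0 ?snorm_ge0//.
rewrite sqrrD !snorm_sqr inner_sqrD//.
have := normr_inner_le Su Sv; rewrite ler_norml => /andP[_ h].
by rewrite mulr2n; lra.
Qed.

Lemma snormZ c u : S u -> snorm B (c *: u) = `|c| * snorm B u.
Proof.
move=> Su; rewrite /snorm innerZl ?innerZr//; last exact: subspaceZ.
by rewrite mulrA -expr2 sqrtrM ?sqr_ge0// sqrtr_sqr.
Qed.

Lemma snormB u v : S u -> S v -> snorm B (u - v) = snorm B (v - u).
Proof.
move=> Su Sv; have Svu := subspaceB Sv Su.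
by rewrite -(opprB v u) -(scaleN1r (v - u)) snormZ// normrN1 mul1r.
Qed.

Lemma snorm0 : snorm B 0 = 0.
Proof. by rewrite /snorm inner0l ?sqrtr0//; exact: semi_inner0 SB. Qed.

Lemma snorm_combination c d u v : S u -> S v ->
  snorm B (c *: u + d *: v) <= `|c| * snorm B u + `|d| * snorm B v.
Proof.
move=> Su Sv; rewrite -!snormZ//.
by apply: snormD; exact: subspaceZ.
Qed.

Lemma snorm_linear_lt c u v (e : R) : S u -> S v ->
  snorm B u < e / 2 / (`|c| + 1) -> snorm B v < e / 2 -> snorm B (c *: u + v) < e.
Proof.
move=> Su Sv ud vd; have Scu := subspaceZ c Su.
rewrite (le_lt_trans (snormD Scu Sv))// snormZ// [ltRHS]splitr; apply: ler_ltD => //.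
rewrite (le_trans (_ : _ <= (`|c| + 1) * (e / 2 / (`|c| + 1))))//.
  by apply: ler_pM => //; [exact: snorm_ge0|rewrite lerDl|exact: ltW].
by rewrite mulrCA divff ?mulr1// gt_eqF// ltr_wpDl.
Qed.

(** The elements of [S] with seminorm zero are not assumed to vanish, and [V]
    carries no topology: limits are determined up to such elements and are
    expressed through the seminorm of differences. *)
Definition scvg T (F : set_system T) (g : T -> V) (l : V) : Prop :=
  [/\ S l, (\forall x \near F, S (g x)) & snorm B (g x - l) @[x --> F] --> 0].

Section scvg_theory.
Context {T : Type} {F : set_system T} {FF : Filter F}.
Implicit Types (g : T -> V) (a : T -> R).

Lemma scvgP g l b : S l -> (\forall x \near F, S (g x)) ->
  (\forall x \near F, snorm B (g x - l) <= b x) -> b x @[x --> F] --> 0 ->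
  scvg F g l.
Proof.
move=> Sl Sg gb b0; split => //.
apply: (@squeeze_cvgr _ _ _ _ (cst 0) b) => //; last exact: cvg_cst.
by apply: filterS gb => x ->; rewrite snorm_ge0.
Qed.

Lemma scvg_cst l : S l -> scvg F (fun=> l) l.
Proof.
move=> Sl; apply: (@scvgP _ _ (cst 0)) => //; try exact: nearW; last exact: cvg_cst.
by apply: nearW => x; rewrite subrr snorm0.
Qed.

Lemma scvgD g g' l l' : scvg F g l -> scvg F g' l' -> scvg F (fun x => g x + g' x) (l + l').
Proof.
move=> [Sl Sg gl] [Sl' Sg' gl'].
apply: (@scvgP _ _ (fun x => snorm B (g x - l) + snorm B (g' x - l'))).
- exact: subspaceD.
- by near=> x; apply: subspaceD; near: x.
- near=> x; rewrite opprD addrACA; apply: snormD; apply: subspaceB => //; near: x; assumption.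
- by rewrite -[X in _ --> X]addr0; apply: cvgD.
Unshelve. all: by end_near. Qed.

Lemma scvgZ a g (c : R) l : a x @[x --> F] --> c -> scvg F g l ->
  scvg F (fun x => a x *: g x) (c *: l).
Proof.
move=> ac [Sl Sg gl].
apply: (@scvgP _ _ (fun x => `|a x| * snorm B (g x - l) + `|a x - c| * snorm B l)).
- exact: subspaceZ.
- by near=> x; apply: subspaceZ; near: x.
- near=> x; have Sgx : S (g x) by near: x.
  have -> : a x *: g x - c *: l = a x *: (g x - l) + (a x - c) *: l.
    by rewrite scalerBr scalerBl addrA subrK.
  rewrite -!snormZ//; last exact: subspaceB.
  by apply: snormD; apply: subspaceZ => //; exact: subspaceB.
- rewrite -[X in _ --> X]addr0; apply: cvgD.
    by rewrite -[X in _ --> X](mulr0 `|c|); apply: cvgM => //; exact: cvg_norm.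
  rewrite -[X in _ --> X](mul0r (snorm B l)); apply: cvgM; last exact: cvg_cst.
  by rewrite -[X in _ --> X](@normr0 R R) -(subrr c); apply: cvg_norm;
    apply: cvgB => //; exact: cvg_cst.
Unshelve. all: by end_near. Qed.

End scvg_theory.

End semi_inner_product.

(** * Twice continuously differentiable functions and curves *)

Section C2_functions.
Context {R : realType}.
Implicit Types (f g : R -> R) (t e : R).

Lemma is_derive_quotient f t (d : R) :
  is_derive t 1 f d <-> h^-1 * (f (t + h) - f t) @[h --> 0^'] --> d.
Proof.
have E : (fun h => h^-1 *: ((f \o shift t) (h *: (1 : R)) - f t)) =
         (fun h => h^-1 * (f (t + h) - f t)).
  by apply/funext => h /=; rewrite [h *: 1]mulr1 (addrC h).
split => [fd|fd].
  by have := @ex_derive _ _ _ _ _ _ _ fd; rewrite /derivable E => /cvg_ex[l fl];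
    have := @derive_val _ _ _ _ _ _ _ fd; rewrite /derive E (cvg_lim _ fl)// => <-.
apply: DeriveDef; first by rewrite /derivable E; apply/cvg_ex; exists d.
by rewrite /derive E; exact: cvg_lim.
Qed.

(** [f1] and [f2] are carried along explicitly so that second derivatives at 0
    can be computed by evaluating the expressions that the closure lemmas below
    produce. *)
Definition C2on e f f1 f2 : Prop := forall t, `|t| < e ->
  [/\ is_derive t 1 f (f1 t), is_derive t 1 f1 (f2 t) & {for t, continuous f2}].

Lemma near_ltr_norm t e : `|t| < e -> \forall s \near t, `|s| < e.
Proof.
move=> te; have : `|s| @[s --> t] --> `|t| by apply: cvg_norm; exact: cvg_id.
by move/cvgr_lt; apply.
Qed.

Lemma C2on_le e e' f f1 f2 : e' <= e -> C2on e f f1 f2 -> C2on e' f f1 f2.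
Proof. by move=> ee fC t te; apply: fC; exact: lt_le_trans ee. Qed.

Lemma C2on_eq e f f1 f2 g : (forall t, `|t| < e -> f t = g t) ->
  C2on e f f1 f2 -> C2on e g f1 f2.
Proof.
move=> fg fC t te; have [d1 d2 c] := fC t te; split => //.
apply: near_eq_is_derive d1; apply: filterS (near_ltr_norm te) => s; exact: fg.
Qed.

Lemma C2on_continuous e f f1 f2 t : C2on e f f1 f2 -> `|t| < e ->
  {for t, continuous f} /\ {for t, continuous f1}.
Proof.
move=> fC te; have [d1 d2 _] := fC t te; split.
  by apply: differentiable_continuous; apply/derivable1_diffP; exact: ex_derive.
by apply: differentiable_continuous; apply/derivable1_diffP; exact: ex_derive.
Qed.

Lemma C2on_cst e (c : R) : C2on e (cst c) (cst 0) (cst 0).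
Proof. by move=> t te; split; [exact: is_derive_cst..|exact: cst_continuous]. Qed.

Lemma C2onD e f f1 f2 g g1 g2 : C2on e f f1 f2 -> C2on e g g1 g2 ->
  C2on e (fun t => f t + g t) (fun t => f1 t + g1 t) (fun t => f2 t + g2 t).
Proof.
move=> fC gC t te; have [df df1 cf] := fC t te; have [dg dg1 cg] := gC t te.
split; [exact: is_deriveD|exact: is_deriveD|exact: continuousD].
Qed.

Lemma C2onM e f f1 f2 g g1 g2 : C2on e f f1 f2 -> C2on e g g1 g2 ->
  C2on e (fun t => f t * g t) (fun t => f1 t * g t + f t * g1 t)
    (fun t => f2 t * g t + 2 * (f1 t * g1 t) + f t * g2 t).
Proof.
move=> fC gC t te; have [df df1 cf] := fC t te; have [dg dg1 cg] := gC t te.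
have [cf0 cf1] := C2on_continuous fC te; have [cg0 cg1] := C2on_continuous gC te.
split.
- apply: (is_derive_eq (is_deriveM df dg)).
  by rewrite /GRing.scale/=; ring.
- apply: (is_derive_eq (is_deriveD (is_deriveM df1 dg) (is_deriveM df dg1))).
  by rewrite /GRing.scale/=; ring.
- apply: cvgD; first apply: cvgD; apply: cvgM => //; first exact: cvg_cst.
  by apply: cvgM.
Qed.

Lemma is_derive_powR_comp (a : R) f t d : 0 < f t -> is_derive t 1 f d ->
  is_derive t 1 (fun s => f s `^ a) (a * f t `^ (a - 1) * d).
Proof.
by move=> f0 fd; exact: is_derive1_comp (is_derive1_powR a f0) fd.
Qed.

Lemma C2on_powR e (a : R) f f1 f2 : (forall t, `|t| < e -> 0 < f t) ->
  C2on e f f1 f2 ->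
  C2on e (fun t => f t `^ a) (fun t => a * f t `^ (a - 1) * f1 t)
    (fun t => a * ((a - 1) * f t `^ (a - 2) * f1 t * f1 t + f t `^ (a - 1) * f2 t)).
Proof.
move=> f0 fC t te; have [df df1 cf2] := fC t te.
have [cf cf1] := C2on_continuous fC te.
have cpow b : {for t, continuous (fun s => f s `^ b)}.
  apply: differentiable_continuous; apply/derivable1_diffP.
  by have := is_derive_powR_comp b (f0 t te) df => dp; exact: ex_derive.
split.
- exact: is_derive_powR_comp (f0 t te) df.
- have dp := is_derive_powR_comp (a - 1) (f0 t te) df.
  apply: (is_derive_eq (is_deriveM (is_deriveM (is_derive_cst a t 1) dp) df1)).
  rewrite (_ : a - 1 - 1 = a - 2); last by ring.
  by rewrite !fctE /GRing.scale/=; ring.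
- apply: cvgM; first exact: cvg_cst.
  apply: cvgD; last by apply: cvgM => //; exact: cpow.
  apply: cvgM => //; apply: cvgM => //; apply: cvgM; first exact: cvg_cst.
  exact: cpow.
Qed.

Lemma C2on_derive2 e f f1 f2 : 0 < e -> C2on e f f1 f2 ->
  has_derive2 f 0 (f2 0).
Proof.
move=> e0 fC; have near0 : \forall s \near (0 : R), `|s| < e.
  by apply: near_ltr_norm; rewrite normr0.
split.
  by apply: filterS near0 => s /fC[d1 _ _]; exact: ex_derive.
have [|_ d2 _] := fC 0; first by rewrite normr0.
apply: near_eq_is_derive d2; apply: filterS near0 => s /fC[d1 _ _].
by rewrite derive1E; apply/esym; exact: derive_val.
Qed.

Lemma C2on_gt0 e f f1 f2 : 0 < e -> C2on e f f1 f2 -> 0 < f 0 ->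
  exists e', [/\ 0 < e', e' <= e & forall t, `|t| < e' -> 0 < f t].
Proof.
move=> e0 fC f0; have [|cf _] := C2on_continuous fC (t := 0); first by rewrite normr0.
have : \forall t \near (0 : R), 0 < f t by move/cvgr_gt: cf; apply.
move=> /nbhs_ballP[d /= d0 H]; exists (Num.min d e); split.
- by rewrite lt_min d0.
- by rewrite ge_min lexx orbT.
- by move=> t; rewrite lt_min => /andP[td _]; apply: H; rewrite /ball/= sub0r normrN.
Qed.

Lemma has_derive2_unique f d d' :
  has_derive2 f 0 d -> has_derive2 f 0 d' -> d = d'.
Proof.
by move=> [_ D] [_ D']; rewrite -(@derive_val _ _ _ _ _ _ _ D) -(@derive_val _ _ _ _ _ _ _ D').
Qed.

End C2_functions.

Section C2_curves.
Context {R : realType} {V : lmodType R}.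
Variables (S : set V) (B : V -> V -> R).
Hypothesis SB : semi_inner S B.
Implicit Types (gamma : R -> V).

Section scvg_inner.
Variable C : V -> V -> R.
Hypotheses (SC : semi_inner S C) (CB : forall u, C u u <= B u u).

Let norm_CB u v : S u -> S v -> `|C u v| <= snorm B u * snorm B v.
Proof.
move=> Su Sv; apply: le_trans (normr_inner_le SC Su Sv) _.
by apply: ler_pM; rewrite ?snorm_ge0// ler_wsqrtr.
Qed.

Lemma scvg_inner T (F : set_system T) {FF : Filter F} (g g' : T -> V) l l' :
  scvg S B F g l -> scvg S B F g' l' -> C (g x) (g' x) @[x --> F] --> C l l'.
Proof.
move=> [Sl Sg gl] [Sl' Sg' gl'].
apply/subr_cvg0.
pose b x := snorm B (g x - l) * (snorm B (g' x - l') + snorm B l') +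
  snorm B l * snorm B (g' x - l').
apply: norm_cvg0; apply: (@squeeze_cvgr _ _ _ _ (cst 0) b); last 2 first.
- exact: cvg_cst.
- rewrite /b -[X in _ --> X]addr0; apply: cvgD.
    rewrite -[X in _ --> X](mul0r (0 + snorm B l')); apply: cvgM => //.
    by apply: cvgD => //; exact: cvg_cst.
  by rewrite -[X in _ --> X](mulr0 (snorm B l)); apply: cvgM => //; exact: cvg_cst.
near=> x; rewrite normr_ge0 /=.
have Sgx : S (g x) by near: x.
have Sgx' : S (g' x) by near: x.
have Sd := subspaceB SB Sgx Sl; have Sd' := subspaceB SB Sgx' Sl'.
have -> : C (g x) (g' x) - C l l' = C (g x - l) (g' x - l') + C (g x - l) l' + C l (g' x - l').
  by rewrite !(innerBl SC, innerBr SC)//; ring.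
rewrite (le_trans (ler_normD _ _))// lerD ?norm_CB// mulrDr.
by rewrite (le_trans (ler_normD _ _))// lerD ?norm_CB.
Unshelve. all: by end_near. Qed.

End scvg_inner.

Lemma scvg_near_eq T (F : set_system T) {FF : Filter F} (g g' : T -> V) l :
  (\forall x \near F, g x = g' x) -> scvg S B F g l -> scvg S B F g' l.
Proof.
move=> gg' [Sl Sg gl]; split => //.
  by near=> x; rewrite -(near gg' x)//; near: x.
apply: cvg_trans gl; apply: near_eq_cvg.
by near=> x; rewrite (near gg' x).
Unshelve. all: by end_near. Qed.

Definition sderiv gamma t d : Prop :=
  S (gamma t) /\ scvg S B 0^' (fun h : R => h^-1 *: (gamma (t + h) - gamma t)) d.

(** Near t the difference of values is at most (1 + |d|) |s - t|. *)
Lemma sderiv_continuous gamma t d : sderiv gamma t d -> scvg S B (nbhs t) gamma (gamma t).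
Proof.
move=> [St [Sd Sq qd]].
have near_bound : \forall s \near t, S (gamma s) /\
    snorm B (gamma s - gamma t) <= (1 + snorm B d) * `|s - t|.
  pose P h := S (h^-1 *: (gamma (t + h) - gamma t)) /\
      snorm B (h^-1 *: (gamma (t + h) - gamma t) - d) < 1.
  have H : \forall h \near 0^', P h.
    by apply: filterI => //; move/cvgr_lt: qd; exact.
  have st0 : s - t @[s --> t] --> 0.
    by rewrite -(subrr t); apply: cvgB; [exact: cvg_id|exact: cvg_cst].
  have {H}H : \forall s \near t, s - t != 0 -> P (s - t) by exact: st0 H.
  apply: filterS H => s; rewrite /P => H.
  have [->|st] := eqVneq s t; first by rewrite !subrr (snorm0 SB) normr0 mulr0.
  have {H} [SQ Q1] : S ((s - t)^-1 *: (gamma s - gamma t)) /\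
      snorm B ((s - t)^-1 *: (gamma s - gamma t) - d) < 1.
    by move: H; rewrite subr_eq0 [t + (s - t)]addrC subrK; exact.
  have E : gamma s - gamma t = (s - t) *: ((s - t)^-1 *: (gamma s - gamma t)).
    by rewrite scalerA divff ?scale1r// subr_eq0.
  have Sst : S (gamma s - gamma t) by rewrite E; exact: (subspaceZ SB).
  split; first by rewrite -(subrK (gamma t) (gamma s)); exact: (subspaceD SB).
  rewrite E (snormZ SB)// mulrC ler_wpM2r//.
  rewrite -[X in snorm B X](subrK d) (le_trans (snormD SB _ _))//; first exact: (subspaceB SB).
  by rewrite lerD2r ltW.
apply: (scvgP (b := fun s => (1 + snorm B d) * `|s - t|)) => //.
- by apply: filterS near_bound => s [].
- by apply: filterS near_bound => s [].
rewrite -[X in _ --> X](mulr0 (1 + snorm B d)); apply: cvgM; first exact: cvg_cst.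
rewrite -(@normr0 _ R) -(subrr t); apply: cvg_norm.
by apply: cvgB; [exact: cvg_id|exact: cvg_cst].
Qed.

Lemma cvg_shift0 (t : R) : t + h @[h --> 0^'] --> t.
Proof.
rewrite -[X in _ --> X]addr0; apply: cvgD; first exact: cvg_cst.
exact: cvg_within.
Qed.

Lemma scvg_shift gamma t l : scvg S B (nbhs t) gamma l -> scvg S B 0^' (fun h => gamma (t + h)) l.
Proof.
have th := @cvg_shift0 t.
move=> [Sl Sg gl]; split => //; first exact: (th _ Sg).
by apply: (cvg_comp _ _ th gl).
Qed.

Lemma sderivZ (f : R -> R) (t a : R) gamma d : is_derive t 1 f a -> sderiv gamma t d ->
  sderiv (fun s => f s *: gamma s) t (a *: gamma t + f t *: d).
Proof.
move=> fa gd; have [St gq] := gd; split; first exact: (subspaceZ SB).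
have /(is_derive_quotient _ _ _).1 fq := fa.
apply: scvg_near_eq (scvgD SB (scvgZ SB fq (scvg_shift (sderiv_continuous gd)))
  (scvgZ SB (cvg_cst (f t)) gq)).
apply: nearW => h /=.
by rewrite scalerA [f t * _]mulrC -scalerA -scalerA -scalerDr scalerBl scalerBr addrA subrK.
Qed.

Lemma sderivD gamma gamma' t d d' : sderiv gamma t d -> sderiv gamma' t d' ->
  sderiv (fun s => gamma s + gamma' s) t (d + d').
Proof.
move=> [St gq] [St' gq']; split; first exact: (subspaceD SB).
apply: scvg_near_eq (scvgD SB gq gq'); apply: nearW => h /=.
by rewrite -scalerDr opprD addrACA.
Qed.

Lemma is_derive_inner (C : V -> V -> R) gamma gamma' t d d' :
  semi_inner S C -> (forall u, C u u <= B u u) ->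
  sderiv gamma t d -> sderiv gamma' t d' ->
  is_derive t 1 (fun s => C (gamma s) (gamma' s)) (C d (gamma' t) + C (gamma t) d').
Proof.
move=> SC CB gd gd'; have [St gq] := gd; have [St' gq'] := gd'.
have [_ Sg _] := scvg_shift (sderiv_continuous gd).
have [_ Sg' _] := scvg_shift (sderiv_continuous gd').
apply/is_derive_quotient.
have lim : C (h^-1 *: (gamma (t + h) - gamma t)) (gamma' (t + h)) +
    C (gamma t) (h^-1 *: (gamma' (t + h) - gamma' t)) @[h --> 0^'] -->
    C d (gamma' t) + C (gamma t) d'.
  apply: cvgD; apply: (scvg_inner SC CB) => //.
    exact: scvg_shift (sderiv_continuous gd').
  exact: scvg_cst.
apply: cvg_trans lim; apply: near_eq_cvg; near=> h.
have S1 : S (gamma (t + h)) by near: h.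
have S2 : S (gamma' (t + h)) by near: h.
have SD1 := subspaceB SB S1 St; have SD2 := subspaceB SB S2 St'.
rewrite (innerZl SC)// (innerZr SC)// (innerBl SC)// (innerBr SC)//; ring.
Unshelve. all: by end_near. Qed.

(** This is [C2_curve] for an arbitrary subspace and seminorm. *)
Definition C2curve (e : R) (gamma gamma1 gamma2 : R -> V) :=
  forall t : R, `|t| < e ->
  [/\ [/\ S (gamma t), S (gamma1 t) & S (gamma2 t)],
      snorm B (h^-1 *: (gamma (t + h) - gamma t) - gamma1 t) @[h --> 0^'] --> 0,
      snorm B (h^-1 *: (gamma1 (t + h) - gamma1 t) - gamma2 t) @[h --> 0^'] --> 0 &
      snorm B (gamma2 s - gamma2 t) @[s --> t] --> 0].

Lemma C2curve_le (e e' : R) gamma gamma1 gamma2 : e' <= e ->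
  C2curve e gamma gamma1 gamma2 -> C2curve e' gamma gamma1 gamma2.
Proof. by move=> ee gC t te; apply: gC; exact: lt_le_trans ee. Qed.

Lemma near0_shift (P : R -> Prop) (t : R) : (\forall s \near t, P s) ->
  \forall h \near 0^', P (t + h).
Proof.
have th := @cvg_shift0 t.
by move=> Pt; exact: (th _ Pt).
Qed.

Lemma C2curve_sderiv e gamma gamma1 gamma2 : C2curve e gamma gamma1 gamma2 <->
  forall t, `|t| < e -> [/\ sderiv gamma t (gamma1 t), sderiv gamma1 t (gamma2 t) &
    scvg S B (nbhs t) gamma2 (gamma2 t)].
Proof.
split=> [gC t te|gC t te]; last first.
  by have [[? [? ? ?]] [? [? ? ?]] [? ? ?]] := gC t te.
have [[S0 S1 S2] d1 d2 c] := gC t te.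
have nearS : \forall s \near t, [/\ S (gamma s), S (gamma1 s) & S (gamma2 s)].
  by apply: filterS (near_ltr_norm te) => s /gC[].
have qS (g : R -> V) : S (g t) -> (\forall s \near t, S (g s)) ->
    \forall h \near 0^', S (h^-1 *: (g (t + h) - g t)).
  move=> Sg /near0_shift; apply: filterS => h Sh.
  by apply: (subspaceZ SB); exact: (subspaceB SB).
by split; split => //; try split => //; try (apply: qS => //);
  apply: filterS nearS => s [].
Qed.

(** A form that is dominated by [B] is continuous for its seminorm, hence the
    product rule holds for it along differentiable curves. *)
Lemma C2curve_inner (C : V -> V -> R) e gamma gamma1 gamma2 :
  semi_inner S C -> (forall u, C u u <= B u u) -> C2curve e gamma gamma1 gamma2 ->
  C2on e (fun t => C (gamma t) (gamma t)) (fun t => 2 * C (gamma t) (gamma1 t))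
   (fun t => 2 * C (gamma1 t) (gamma1 t) + 2 * C (gamma t) (gamma2 t)).
Proof.
move=> SC CB /C2curve_sderiv gC t te; have [d0 d1 c2] := gC t te.
have c0 := sderiv_continuous d0; have c1 := sderiv_continuous d1.
split.
- apply: (is_derive_eq (is_derive_inner SC CB d0 d0)).
  by rewrite (semi_innerC SC (gamma1 t)); ring.
- have dd := is_derive_inner SC CB d0 d1.
  apply: (is_derive_eq (is_deriveZ 2 dd)).
  by rewrite /GRing.scale/=; ring.
- apply: cvgD; apply: cvgM; try exact: cvg_cst.
    exact: (scvg_inner SC CB c1 c1).
  exact: (scvg_inner SC CB c0 c2).
Qed.

Lemma C2curveZ e (f f1 f2 : R -> R) gamma gamma1 gamma2 :
  C2on e f f1 f2 -> C2curve e gamma gamma1 gamma2 ->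
  C2curve e (fun t => f t *: gamma t) (fun t => f1 t *: gamma t + f t *: gamma1 t)
   (fun t => (f2 t *: gamma t + f1 t *: gamma1 t) + (f1 t *: gamma1 t + f t *: gamma2 t)).
Proof.
move=> fC /C2curve_sderiv gC; apply/C2curve_sderiv => t te.
have [d0 d1 c2] := gC t te; have [fd0 fd1 fc2] := fC t te.
have [fc0 fc1] := C2on_continuous fC te.
have c0 := sderiv_continuous d0; have c1 := sderiv_continuous d1.
split; [exact: sderivZ|by apply: sderivD; exact: sderivZ|].
by do 2?apply: (scvgD SB); apply: (scvgZ SB).
Qed.

Lemma C2curve_line e u v : S u -> S v ->
  C2curve e (fun t => u + t *: v) (cst v) (cst 0).
Proof.
move=> Su Sv; have S0 := semi_inner0 SB; apply/C2curve_sderiv => t te; split.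
- split; first by apply: (subspaceD SB) => //; exact: (subspaceZ SB).
  apply: scvg_near_eq (scvg_cst SB Sv); near=> h.
  have h0 : h != 0 by near: h; exact: nbhs_dnbhs_neq.
  by rewrite opprD addrACA subrr add0r -scalerBl addrAC subrr add0r scalerA mulVf// scale1r.
- split => //; apply: scvg_near_eq (scvg_cst SB S0); apply: nearW => h.
  by rewrite /= subrr scaler0.
- exact: scvg_cst.
Unshelve. all: by end_near. Qed.

End C2_curves.

(** * Powers of the absolute value *)

Section norm_powR.
Context {R : realType}.
Implicit Types (p q x h : R).

Lemma norm_powR_cvg0 q : 0 < q -> `|h| `^ q @[h --> (0 : R)] --> (0 : R).
Proof.
move=> q0; apply/cvgrPdist_lt => e e0.
have d0 : 0 < e `^ q^-1 by exact: powR_gt0.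
near=> h; rewrite sub0r normrN ger0_norm ?powR_ge0//.
have -> : e = (e `^ q^-1) `^ q by rewrite -powRrM mulVf ?gt_eqF// powRr1// ltW.
have hlt : `|h| < e `^ q^-1 by near: h; apply: (@near_ltr_norm R 0); rewrite normr0.
by apply: gt0_ltr_powR; rewrite ?nnegrE ?normr_ge0 ?powR_ge0.
Unshelve. all: by end_near. Qed.

Lemma norm_powRD2 q x : 0 < q -> `|x| `^ (q + 2) = `|x| `^ q * x ^+ 2.
Proof.
move=> q0; have [->|x0] := eqVneq x 0.
  by rewrite normr0 expr0n/= mulr0 powR0// gt_eqF// addr_gt0.
rewrite powRD; last by rewrite normr_eq0 x0 implybT.
by rewrite powR_mulrn// real_normK// num_real.
Qed.

(** Near x the absolute value is the linear function y |-> sg(x) y. *)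
Lemma is_derive_norm_powR_neq0 q x : x != 0 ->
  is_derive x 1 (fun y : R => `|y| `^ q) (q * `|x| `^ (q - 1) * Num.sg x).
Proof.
move=> x0; have dlin : is_derive x 1 (fun y : R => Num.sg x * y) (Num.sg x).
  apply: (is_derive_eq (is_deriveZ (Num.sg x) (is_derive_id x 1))).
  by rewrite /GRing.scale/= mulr1.
have sx : Num.sg x * x = `|x| by rewrite normrEsg.
have := @is_derive_powR_comp R q (fun y => Num.sg x * y) x (Num.sg x).
rewrite sx normr_gt0 => /(_ x0 dlin); apply: near_eq_is_derive.
near=> y; congr (_ `^ _).
have : `|y - x| < `|x|.
  near: y; have : y - x @[y --> x] --> x - x by apply: cvgB; [exact: cvg_id|exact: cvg_cst].
  by rewrite subrr => /cvgr0_norm_lt; apply; rewrite normr_gt0.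
have [x_lt|x_gt|E] := ltgtP x 0; last by have := x0; rewrite E eqxx.
  rewrite ltr0_sg// (ltr0_norm x_lt) ltr_norml => /andP[_ yx].
  by rewrite mulN1r ltr0_norm//; lra.
rewrite gtr0_sg// (gtr0_norm x_gt) ltr_norml => /andP[yx _].
by rewrite mul1r gtr0_norm//; lra.
Unshelve. all: by end_near. Qed.

Lemma continuous_norm_powR q : 0 < q -> continuous (fun x : R => `|x| `^ q).
Proof.
move=> q0 x; have [->|x0] := eqVneq x 0.
  by rewrite /continuous_at normr0 powR0 ?gt_eqF//; exact: norm_powR_cvg0.
have d := is_derive_norm_powR_neq0 q x0.
by apply: differentiable_continuous; apply/derivable1_diffP; exact: ex_derive.
Qed.

Lemma norm_powRB1_sg q x : 0 < q -> `|x| `^ (q + 1) * Num.sg x = `|x| `^ q * x.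
Proof.
move=> q0; have [->|x0] := eqVneq x 0; first by rewrite sgr0 !mulr0.
rewrite powRD ?normr_eq0 ?x0 ?implybT// powRr1//.
by rewrite -mulrA [`|x| * _]mulrC mulr_sg_norm.
Qed.

(** At 0 the difference quotient is |h|^(p-2) h, which tends to 0. Since p > 2
    the derivative is itself differentiable at 0, see
    [is_derive_norm_powR_mul]. *)
Lemma is_derive_norm_powR p x : 2 < p ->
  is_derive x 1 (fun y : R => `|y| `^ p) (p * (`|x| `^ (p - 2) * x)).
Proof.
move=> p2; have q0 : 0 < p - 2 by lra.
have [->|x0] := eqVneq x 0; last first.
  apply: (is_derive_eq (is_derive_norm_powR_neq0 p x0)).
  rewrite -mulrA; congr (_ * _); rewrite -norm_powRB1_sg//.
  by congr (_ `^ _ * _); ring.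
rewrite !mulr0; apply/is_derive_quotient.
have : `|h| `^ (p - 2) * h @[h --> (0 : R)^'] --> (0 : R).
  rewrite -[X in _ --> X](mulr0 0); apply: cvgM; last exact: cvg_within.
  exact: cvg_within_filter (norm_powR_cvg0 q0).
apply: cvg_trans; apply: near_eq_cvg; near=> h.
have h0 : h != 0 by near: h; exact: nbhs_dnbhs_neq.
rewrite add0r normr0 powR0 ?gt_eqF//; last lra.
have -> : `|h| `^ p = `|h| `^ (p - 2) * h ^+ 2 by rewrite -norm_powRD2// subrK.
by rewrite subr0 mulrCA expr2 mulKf.
Unshelve. all: by end_near. Qed.

Lemma is_derive_norm_powR_mul q x : 0 < q ->
  is_derive x 1 (fun y : R => `|y| `^ q * y) ((q + 1) * `|x| `^ q).
Proof.
move=> q0; have [->|x0] := eqVneq x 0; last first.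
  apply: (is_derive_eq (is_deriveM (is_derive_norm_powR_neq0 q x0) (is_derive_id x 1))).
  rewrite /GRing.scale/= mulr1.
  have E : x * (q * `|x| `^ (q - 1) * Num.sg x) = q * `|x| `^ q.
    transitivity (q * (Num.sg x * x * `|x| `^ (q - 1))); first by ring.
    by rewrite -normrEsg mulr_powRB1.
  by rewrite E; ring.
rewrite normr0 powR0 ?gt_eqF// mulr0; apply/is_derive_quotient.
have : `|h| `^ q @[h --> (0 : R)^'] --> (0 : R).
  exact: cvg_within_filter (norm_powR_cvg0 q0).
apply: cvg_trans; apply: near_eq_cvg; near=> h.
have h0 : h != 0 by near: h; exact: nbhs_dnbhs_neq.
by rewrite add0r mulr0 subr0 mulrC mulfK.
Unshelve. all: by end_near. Qed.

End norm_powR.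

(** * Differentiation of integrals along lines *)

Section integral_along_line.
Context {R : realType} d {T : measurableType d} {mu : {measure set T -> \bar R}}.
Implicit Types (f g w G : T -> R) (phi : R -> R).

Lemma continuous_of_derive phi phi' :
  (forall x : R, is_derive x 1 phi (phi' x)) -> continuous phi.
Proof.
move=> dphi x; have := dphi x => dx.
by apply: differentiable_continuous; apply/derivable1_diffP; exact: ex_derive.
Qed.

Lemma integrable_along_line phi f g w G (t : R) : continuous phi ->
  measurable_fun setT f -> measurable_fun setT g -> measurable_fun setT w ->
  mu.-integrable setT (EFin \o G) ->
  (forall x, `|phi (f x + t * g x) * w x| <= G x) ->
  mu.-integrable setT (EFin \o (fun x => phi (f x + t * g x) * w x)).
Proof.
move=> cphi mf mg mw iG phiG; apply: le_integrable iG => //.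
  apply/measurable_EFinP/measurable_funM => //.
  apply: (measurableT_comp (continuous_measurable_fun cphi)).
  by apply: measurable_funD => //; exact: measurable_funM.
by move=> x _; rewrite lee_fin (le_trans (phiG x))// ler_norm.
Qed.

(** The weight [w] allows this to be iterated: differentiating
    phi (f + s g) w multiplies the weight by g. *)
Lemma is_derive_integral_along_line phi phi' f g w G (e t : R) :
  (forall x : R, is_derive x 1 phi (phi' x)) ->
  measurable_fun setT f -> measurable_fun setT g -> measurable_fun setT w ->
  mu.-integrable setT (EFin \o G) ->
  (forall s x, `|s| < e -> `|phi (f x + s * g x) * w x| <= G x /\
    `|phi' (f x + s * g x) * (g x * w x)| <= G x) -> `|t| < e ->
  is_derive t 1 (fun s => \int[mu]_x (phi (f x + s * g x) * w x))%R
    (\int[mu]_x (phi' (f x + t * g x) * (g x * w x)))%R.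
Proof.
move=> dphi mf mg mw iG dom te.
have cphi := continuous_of_derive dphi.
have It : `]-e, e[%classic t by rewrite /= in_itv/= -ltr_norml.
have inI s : `]-e, e[%classic s -> `|s| < e by rewrite /= in_itv/= -ltr_norml.
pose F s x := phi (f x + s * g x) * w x.
have dF (s : R) x : is_derive s 1 (F ^~ x) (phi' (f x + s * g x) * (g x * w x)).
  have dl : is_derive s 1 (fun s : R => f x + s * g x) (g x).
    have := is_deriveD (is_derive_cst (f x) s 1)
      (is_deriveM (is_derive_id s 1) (is_derive_cst (g x) s 1)).
    move=> dd; apply: (is_derive_eq dd).
    by rewrite !fctE /GRing.scale/=; ring.
  have dc := @is_derive1_comp R phi (fun s => f x + s * g x) s _ _ (dphi _) dl.
  apply: (is_derive_eq (is_deriveM dc (is_derive_cst (w x) s 1))).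
  by rewrite !fctE /GRing.scale/=; ring.
have d1F (s : R) x : partial1of2 F s x = phi' (f x + s * g x) * (g x * w x).
  by rewrite partial1of2E; have /@derive_val := dF s x.
have iF s : `]-e, e[%classic s -> mu.-integrable setT (EFin \o F s).
  by move=> /inI se; apply: integrable_along_line iG _ => // x; have [] := dom s x se.
have derF s x : `]-e, e[%classic s -> setT x -> derivable (F ^~ x) s 1.
  by move=> _ _; have /@ex_derive := dF s x.
have G0 x : 0 <= G x by have [+ _] := dom t x te; apply: le_trans.
have domF s x : `]-e, e[%classic s -> setT x -> `|partial1of2 F s x| <= G x.
  by move=> /inI se _; rewrite d1F; have [] := dom s x se.
apply: DeriveDef.
  exact: (derivable_under_integral measurableT It iF derF G0 iG domF).
rewrite -derive1E (differentiation_under_integral measurableT It iF derF G0 iG domF).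
by apply: eq_Rintegral => x _; rewrite d1F.
Qed.

Lemma C2on_integral_along_line phi phi1 phi2 f g G (e : R) :
  (forall x : R, is_derive x 1 phi (phi1 x)) ->
  (forall x : R, is_derive x 1 phi1 (phi2 x)) -> continuous phi2 ->
  measurable_fun setT f -> measurable_fun setT g ->
  mu.-integrable setT (EFin \o G) ->
  (forall s x, `|s| < e -> [/\ `|phi (f x + s * g x)| <= G x,
    `|phi1 (f x + s * g x) * g x| <= G x &
    `|phi2 (f x + s * g x) * (g x * g x)| <= G x]) ->
  C2on e (fun s => \int[mu]_x phi (f x + s * g x))%R
    (fun s => \int[mu]_x (phi1 (f x + s * g x) * g x))%R
    (fun s => \int[mu]_x (phi2 (f x + s * g x) * (g x * g x)))%R.
Proof.
move=> d0 d1 c2 mf mg iG dom t te; split.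
- have := @is_derive_integral_along_line phi phi1 f g (cst 1) G e t d0 mf mg
    (measurable_cst _) iG.
  under eq_fun do under eq_Rintegral do rewrite mulr1.
  under [in X in is_derive _ _ _ X]eq_Rintegral do rewrite mulr1.
  apply => // s x se; have [h0 h1 _] := dom s x se; by rewrite !mulr1.
- apply: (is_derive_integral_along_line d1 mf mg mg iG) te => s x se.
  by have [_ h1 h2] := dom s x se.
- have It : `]-e, e[%classic t by rewrite /= in_itv/= -ltr_norml.
  have inI s : `]-e, e[%classic s -> `|s| < e by rewrite /= in_itv/= -ltr_norml.
  apply: (@continuity_under_integral R _ _ mu (fun s x => phi2 (f x + s * g x) * (g x * g x))
    setT measurableT (-e) e _ _ G iG) => //.
  + move=> s /inI se; apply: integrable_along_line iG _ => //.
      exact: measurable_funM.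
    by move=> x; have [] := dom s x se.
  + apply: aeW => x _ s _; apply: cvgM; last exact: cvg_cst.
    apply: (@continuous_comp R R R (fun s => f x + s * g x) phi2); last exact: c2.
    by apply: cvgD; [exact: cvg_cst|apply: cvgM; [exact: cvg_id|exact: cvg_cst]].
  + by move=> s /inI se; apply: aeW => x _; have [] := dom s x se.
  + exact/mem_set.
Qed.

Lemma Lfun_normr (p : \bar R) f : f \in Lfun mu p -> (fun x => `|f x|) \in Lfun mu p.
Proof.
rewrite !inE => /andP[/[!inE]/= mf nf]; apply/andP; split; rewrite inE/=.
  exact: measurableT_comp.
by rewrite /finite_norm -[X in Lnorm _ _ X]/(abse \o (EFin \o f)) Lnorm_abse.
Qed.

(** The functional w |-> |w|_p^p / p is twice continuously differentiable along
    lines of L^p. For |s| < e all the integrands are dominated by p h^p where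
    h = (1 + |e|) (|f| + |g|) is in L^p. The factor 1 / p makes the first
    derivative the integral that occurs in the weak equation. *)
Lemma C2on_integral_powR (p e : R) f g : 2 < p -> f \in Lfun mu p%:E -> g \in Lfun mu p%:E ->
  C2on e (fun s => \int[mu]_x (p^-1 * `|f x + s * g x| `^ p))%R
    (fun s => \int[mu]_x (`|f x + s * g x| `^ (p - 2) * (f x + s * g x) * g x))%R
    (fun s => \int[mu]_x ((p - 2 + 1) * `|f x + s * g x| `^ (p - 2) * (g x * g x)))%R.
Proof.
move=> p2 fp gp; have p1 : 1 <= p by lra.
have p1' : (1 <= p%:E)%E by rewrite lee_fin.
have q0 : 0 < p - 2 by lra.
have [mf mg] : measurable_fun setT f /\ measurable_fun setT g.
  by move: fp gp; rewrite !inE => /andP[/[!inE]/= ? _] /andP[/[!inE]/= ? _].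
pose K := 1 + `|e|.
pose h x := K * (`|f x| + `|g x|).
have K1 : 1 <= K by rewrite lerDl.
have hp : h \in Lfun mu p%:E.
  rewrite (_ : h = K *: ((fun x => `|f x|) + (fun x => `|g x|)) + 0); last first.
    by rewrite addr0.
  apply: (Lfun_submod_closed mu p1').2; last exact: (Lfun_submod_closed mu p1').1.
  rewrite -[X in X + _]scale1r.
  by apply: (Lfun_submod_closed mu p1').2; exact: Lfun_normr.
pose G x := p * (`|h x| `^ p).
have iG : mu.-integrable setT (EFin \o G).
  have := @integrableZl _ _ _ mu _ measurableT p _ (Lfun_integrable p1 hp).
  by congr (integrable _ _ _); apply/funext => x /=; rewrite -EFinM.
have cphi2 : continuous (fun x : R => (p - 2 + 1) * `|x| `^ (p - 2)).
  by move=> x; apply: cvgM; [exact: cvg_cst|exact: continuous_norm_powR].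
apply: (@C2on_integral_along_line (fun x => p^-1 * `|x| `^ p)
   (fun x => `|x| `^ (p - 2) * x)
   (fun x => (p - 2 + 1) * `|x| `^ (p - 2)) f g G e) => //.
- move=> x; apply: (is_derive_eq (is_deriveZ p^-1 (is_derive_norm_powR x p2))).
  by rewrite /GRing.scale/= mulKf// gt_eqF//; lra.
- by move=> x; exact: is_derive_norm_powR_mul.
move=> s x se; have h0 : 0 <= h x by rewrite mulr_ge0 ?addr_ge0// (le_trans _ K1).
have [f0 g0] : 0 <= `|f x| /\ 0 <= `|g x| by [].
have sK : `|s| <= K by rewrite /K (le_trans (ltW se))// (le_trans (ler_norm _))// lerDr.
have gh : `|g x| <= h x by rewrite /h; nra.
have fh : `|f x + s * g x| <= h x.
  by rewrite (le_trans (ler_normD _ _))// normrM /h; nra.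
set y := f x + s * g x in fh *.
have pow_le a : 0 < a -> `|y| `^ a <= h x `^ a.
  by move=> a0; apply: ge0_ler_powR; rewrite ?nnegrE// ltW.
have hsplit : h x `^ p = h x `^ (p - 2) * h x ^+ 2.
  by rewrite -{1}(subrK 2 p) -[in LHS](ger0_norm h0) norm_powRD2// ger0_norm.
have H0 : 0 <= h x `^ p by exact: powR_ge0.
have q0' : 0 <= `|y| `^ (p - 2) by exact: powR_ge0.
have pV1 : p^-1 <= p by rewrite (le_trans _ p1)// invf_le1//; lra.
rewrite /G (ger0_norm h0); split.
- rewrite normrM (ger0_norm (powR_ge0 _ _)) ger0_norm ?invr_ge0; last lra.
  by apply: ler_pM => //; rewrite ?invr_ge0 ?powR_ge0 ?pow_le//; lra.
- rewrite !normrM (ger0_norm q0').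
  apply: (@le_trans _ _ (h x `^ p)); last by rewrite ler_peMl.
  by rewrite hsplit -mulrA expr2 ler_pM ?mulr_ge0 ?pow_le ?ler_pM.
- rewrite !normrM (ger0_norm q0') (@ger0_norm _ (p - 2 + 1)); last lra.
  rewrite -!mulrA; apply: ler_pM; [lra|by rewrite !mulr_ge0|lra|].
  by rewrite hsplit expr2 ler_pM ?mulr_ge0 ?pow_le ?ler_pM.
Qed.

End integral_along_line.

(** * The space H^1_0 and null functions *)

Section H10_space.
Context {R : realType} {N : nat}.
Variable Omega : set 'rV[R]_N.
Implicit Types (u v w : sobolev R N).

Local Notation dotL2 := (dotL2 Omega).
Local Notation dotgrad := (dotgrad Omega).

Definition dotH1 u v := dotL2 u v + dotgrad u v.

Lemma dotL2_le_dotH1 v : dotL2 v v <= dotH1 v v.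
Proof. by rewrite lerDl dotgrad_ge0. Qed.

Lemma dotgrad_le_dotH1 v : dotgrad v v <= dotH1 v v.
Proof. by rewrite lerDr dotL2_ge0. Qed.

Lemma normH1_snorm : normH1 Omega = snorm dotH1.
Proof. by apply/funext => u; rewrite normH1E. Qed.

Lemma semi_inner_subset (V : lmodType R) (S S' : set V) B : semi_inner S B ->
  S' `<=` S -> S' 0 -> (forall c x y, S' x -> S' y -> S' (c *: x + y)) -> semi_inner S' B.
Proof.
move=> SB sub S0 Slin; split => //; [exact: semi_innerC SB| |exact: semi_inner_ge0 SB].
by move=> c x y z Sx Sy Sz; apply: (semi_inner_linearl SB); exact: sub.
Qed.

(** The member [u] witnesses that the subspace contains 0. *)
Lemma H1_semi_inner u : H1 Omega u ->
  [/\ semi_inner (H1 Omega) dotL2, semi_inner (H1 Omega) dotgrad & semi_inner (H1 Omega) dotH1].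
Proof.
move=> uH; have H0 : H1 Omega 0.
  by rewrite -(addNr u) -scaleN1r; exact: H1_linear.
split; split => //; try exact: H1_linear.
- exact: dotL2C.
- exact: dotL2_linearl.
- exact: dotL2_ge0.
- exact: dotgradC.
- exact: dotgrad_linearl.
- exact: dotgrad_ge0.
- by move=> v w; rewrite /dotH1 dotL2C dotgradC.
- by move=> c v w z v1 w1 z1; rewrite /dotH1 dotL2_linearl// dotgrad_linearl//; ring.
- by move=> v; rewrite addr_ge0 ?dotL2_ge0 ?dotgrad_ge0.
Qed.

(** Approximating u and v by test functions phi and psi, one approximates
    c u + v by c phi + psi. *)
Lemma H10_linear (c : R) u v : H10 Omega u -> H10 Omega v -> H10 Omega (c *: u + v).
Proof.
move=> [u1 ua] [v1 va]; have [_ _ SB] := H1_semi_inner u1.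
split; first exact: H1_linear.
move=> e e0.
have d0 : 0 < e / 2 / (`|c| + 1) by rewrite !divr_gt0// ltr_wpDl.
have [phi [cphi uphi]] := ua _ d0.
have [psi [cpsi vpsi]] : exists psi, Cc_infty Omega psi /\
    normH1 Omega (v - (psi, gradient psi)) < e / 2.
  by apply: va; rewrite divr_gt0.
exists (fun x => c * phi x + psi x); split; first exact: Cc_infty_linear.
have -> : c *: u + v - (fun x => c * phi x + psi x, gradient (fun x => c * phi x + psi x))
   = c *: (u - (phi, gradient phi)) + (v - (psi, gradient psi)).
  rewrite (gradient_linear c cphi cpsi) scalerBr addrACA -opprD; congr (_ + _ - _).
move: uphi vpsi; rewrite normH1_snorm => uphi vpsi.
have S1 := subspaceB SB u1 (Cc_infty_H1 cphi).
have S2 := subspaceB SB v1 (Cc_infty_H1 cpsi).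
exact: (snorm_linear_lt SB S1 S2 uphi vpsi).
Qed.

Lemma H10_semi_inner u : H10 Omega u ->
  [/\ semi_inner (H10 Omega) dotL2, semi_inner (H10 Omega) dotgrad & semi_inner (H10 Omega) dotH1].
Proof.
move=> uH; have [SB0 SB1 SB] := H1_semi_inner uH.1.
have H0 : H10 Omega 0.
  by rewrite -(addNr u) -scaleN1r; exact: H10_linear.
have sub : H10 Omega `<=` H1 Omega by move=> ? [].
split.
- by apply: semi_inner_subset SB0 sub H0 _; exact: H10_linear.
- by apply: semi_inner_subset SB1 sub H0 _; exact: H10_linear.
- by apply: semi_inner_subset SB sub H0 _; exact: H10_linear.
Qed.

Lemma Cc_infty_H10 phi : Cc_infty Omega phi -> H10 Omega (phi, gradient phi).
Proof.
move=> cphi; have H := Cc_infty_H1 cphi; split => // e e0; exists phi; split => //.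
have [_ _ SB] := H1_semi_inner H.
by rewrite subrr normH1_snorm (snorm0 SB).
Qed.

End H10_space.

Section null_functions.
Context {R : realType} {N : nat}.
Variable Omega : set 'rV[R]_N.
Implicit Types (f g : 'rV[R]_N -> R).

Definition null f := {ae leb N, forall x, Omega x -> f x = 0}.

Lemma L2_measurable f : L2 Omega f -> measurable_fun setT (f \_ Omega).
Proof. by rewrite /L2/= inE => /andP[/[!inE]]. Qed.

Lemma null_restrict f : null f <-> (f \_ Omega = cst 0 %[ae leb N]).
Proof.
split; apply: filterS => x /=; rewrite patchE.
  by case: ifPn => // /set_mem Ox fx _; exact: fx.
by move=> h Ox; move: (h Logic.I); rewrite mem_set.
Qed.

Lemma intO_ae_eq f g : measurable_fun setT (f \_ Omega) -> measurable_fun setT (g \_ Omega) ->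
  {ae leb N, forall x, Omega x -> f x = g x} -> intO Omega f = intO Omega g.
Proof.
move=> mf mg fg; rewrite !intOE /Rintegral; congr fine.
apply: ae_eq_integral => //; [exact/measurable_EFinP|exact/measurable_EFinP|].
apply: filterS fg => x fg _; rewrite !patchE.
by case: ifPn => // /set_mem /fg ->.
Qed.

Lemma restrict_comp0 (phi : R -> R) f : phi 0 = 0 -> (phi \o f) \_ Omega = phi \o (f \_ Omega).
Proof. by move=> phi0; apply/funext => x /=; rewrite !patchE; case: ifP. Qed.

Lemma null_intO (phi : R -> R) f : phi 0 = 0 -> measurable_fun setT phi ->
  measurable_fun setT (f \_ Omega) -> null f -> intO Omega (phi \o f) = 0.
Proof.
move=> phi0 mphi mf f0; rewrite (@intO_ae_eq _ (cst 0)).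
- rewrite intOE (_ : _ \_ _ = cst 0); last by apply/funext => x; rewrite patchE; case: ifP.
  by rewrite /Rintegral integral0.
- by rewrite restrict_comp0//; exact: measurableT_comp.
- rewrite (_ : _ \_ _ = cst 0)//.
  by apply/funext => x; rewrite patchE; case: ifP.
- by apply: filterS f0 => x h Ox /=; rewrite h.
Qed.

Lemma intO_eq0_null (phi : R -> R) f : phi 0 = 0 -> measurable_fun setT phi ->
  (forall x, x != 0 -> 0 < phi x) -> measurable_fun setT (f \_ Omega) ->
  integrableO Omega (phi \o f) -> intO Omega (phi \o f) = 0 -> null f.
Proof.
move=> phi0 mphi phi_gt0 mf; rewrite /integrableO intOE restrict_comp0// => iphi h.
have phige x : 0 <= phi x by have [->|/phi_gt0/ltW] := eqVneq x 0; rewrite ?phi0.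
have mphif : measurable_fun setT (EFin \o (phi \o (f \_ Omega))).
  by apply/measurable_EFinP; exact: measurableT_comp.
have fin := integrable_fin_num measurableT iphi.
have int0 : (\int[leb N]_x `|(EFin \o (phi \o (f \_ Omega))) x|)%E = 0%E.
  by under eq_integral => x _ do rewrite gee0_abs ?lee_fin ?phige//;
    rewrite -(fineK fin); congr EFin.
apply/null_restrict.
have := (ae_eq_integral_abs (leb N) measurableT mphif).1 int0.
apply: filterS => x /= /(_ Logic.I)[fx0] _.
by apply/eqP/negPn/negP => /phi_gt0; rewrite fx0 ltxx.
Qed.

End null_functions.

(** * Energy, action and the two manifolds *)

Section functionals.
Context {R : realType} {N : nat}.
Variables (Omega : set 'rV[R]_N) (p lambda : R).
Implicit Types (u v w : sobolev R N).
Hypothesis p2 : 2 < p.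

Local Notation dotL2 := (dotL2 Omega).
Local Notation dotgrad := (dotgrad Omega).

Let p_gt0 : 0 < p. Proof. exact: lt_trans p2. Qed.
Let p_neq0 : p != 0. Proof. by rewrite gt_eqF. Qed.
Let p_ge1 : 1 <= p. Proof. by rewrite ltW// (lt_trans _ p2)// ltr1n. Qed.

Definition powR_integral w := intO Omega (fun x => `|w.1 x| `^ p).
(** The quadratic part of the action: the Nehari manifold is given by
    [dotJ w w = powR_integral w]. *)
Definition dotJ u v := dotgrad u v + lambda * dotL2 u v.

Lemma normL_pE w : normL Omega p w.1 `^ p = powR_integral w.
Proof. by rewrite normL_powR. Qed.

Lemma energyE w : energy Omega p w = dotgrad w w / 2 - powR_integral w / p.
Proof. by rewrite /energy normgradE normL_pE. Qed.

Lemma actionE w : action Omega p lambda w = dotJ w w / 2 - powR_integral w / p.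
Proof. by rewrite /action normgradE normL2E normL_pE /dotJ; field. Qed.

Lemma mass_manifoldE mu w :
  mass_manifold Omega mu w <-> H10 Omega w /\ dotL2 w w = 2 * mu.
Proof.
rewrite /mass_manifold/= normL2E; split=> -[h e]; split => //; first by rewrite -e; field.
by rewrite e; field.
Qed.

Lemma nehariE w : nehari Omega p lambda w <->
  [/\ H10 Omega w, nonzero Omega w & dotJ w w = powR_integral w].
Proof. by rewrite /nehari/= normL2E normgradE normL_pE. Qed.

Lemma powR_integral_ge0 w : 0 <= powR_integral w.
Proof. by apply: intO_ge0 => x; exact: powR_ge0. Qed.

Lemma measurable_norm_powR (q : R) : measurable_fun setT (fun x : R => `|x| `^ q).
Proof.
by apply: (measurableT_comp (measurable_powR q)); exact: (@normr_measurable R setT).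
Qed.

(** Homogeneity is also true when the integral is infinite, both sides being
    then 0 by default. *)
Lemma powR_integralZ c w : L2 Omega w.1 -> powR_integral (c *: w) = `|c| `^ p * powR_integral w.
Proof.
move=> /L2_measurable mw; rewrite /powR_integral !intOE.
have p0 : `|0 : R| `^ p = 0 by rewrite normr0 powR0.
pose g x := `|(w.1 \_ Omega) x| `^ p.
rewrite (_ : _ \_ _ = (fun x => `|c| `^ p * g x)); last first.
  apply/funext => x; rewrite /g !patchE; case: ifP => _; last by rewrite p0 mulr0.
  by rewrite (_ : (c *: w).1 x = c * w.1 x)// normrM powRM.
rewrite (_ : (fun x => `|w.1 x| `^ p) \_ _ = g); last first.
  by apply/funext => x; rewrite /g !patchE; case: ifP.
rewrite /Rintegral; under eq_integral do rewrite EFinM.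
rewrite ge0_integralZl_EFin ?powR_ge0//; last 2 first.
- by move=> x _; rewrite lee_fin powR_ge0.
- by apply/measurable_EFinP; exact: (measurableT_comp (measurable_norm_powR p)).
have : (0 <= \int[leb N]_x (g x)%:E)%E.
  by apply: integral_ge0 => x _; rewrite lee_fin powR_ge0.
case: (\int[leb N]_x _)%E => [r||]//= _.
have [->|c0] := eqVneq (`|c| `^ p) 0; first by rewrite mul0e mul0r.
by rewrite gt0_muley ?mulr0// lte_fin lt_neqAle eq_sym c0 powR_ge0.
Qed.

(** A nonzero value cannot be the default one, so positivity detects
    membership in L^p. *)
Lemma powR_integral_gt0_Lfun w : L2 Omega w.1 -> 0 < powR_integral w ->
  w.1 \_ Omega \in Lfun (leb N) p%:E.
Proof.
move=> /L2_measurable mw; rewrite -normL_pE => n0.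
rewrite inE; apply/andP; split; first by rewrite inE.
rewrite inE/= /finite_norm ltNge leye_eq; apply/eqP => h.
by move: n0; rewrite /normL h/= powR0 ?ltxx//.
Qed.

Lemma powR_integral_null w : L2 Omega w.1 -> null Omega w.1 -> powR_integral w = 0.
Proof.
move=> /L2_measurable mw w0.
apply: (null_intO (phi := fun x : R => `|x| `^ p)) => //; last exact: measurable_norm_powR.
by rewrite normr0 powR0//.
Qed.

Lemma dotL2_null w : L2 Omega w.1 -> null Omega w.1 -> dotL2 w w = 0.
Proof.
move=> /L2_measurable mw w0.
have mphi : measurable_fun setT (fun x : R => x * x) by exact: measurable_funM.
by apply: (null_intO (phi := fun x : R => x * x)) => //; rewrite mulr0.
Qed.

Lemma dotL2_eq0_null w : L2 Omega w.1 -> dotL2 w w = 0 -> null Omega w.1.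
Proof.
move=> w2; have mw := L2_measurable w2.
apply: (@intO_eq0_null _ _ _ (fun x : R => x * x)) => //; first by rewrite mulr0.
- exact: measurable_funM.
- by move=> x x0; rewrite -expr2 exprn_even_gt0.
- exact: L2_mul_integrable.
Qed.

Lemma powR_integral_line e u v :
  u.1 \_ Omega \in Lfun (leb N) p%:E -> v.1 \_ Omega \in Lfun (leb N) p%:E ->
  exists F1 F2, C2on e (fun s => powR_integral (u + s *: v)) F1 F2 /\
    F1 0 = p * intO Omega (fun x => `|u.1 x| `^ (p - 2) * u.1 x * v.1 x).
Proof.
move=> up vp; have := C2onM (@C2on_cst R e p) (@C2on_integral_powR _ _ _ (leb N) p e _ _ p2 up vp).
set F1 := (X in C2on _ _ X _); set F2 := (X in C2on _ _ _ X) => FC.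
exists F1, F2; split.
  apply: C2on_eq FC => s _; rewrite /powR_integral intOE -RintegralZl//.
    apply: eq_Rintegral => x _; rewrite !patchE; case: ifP => _.
      by rewrite mulVKf//.
    by rewrite mulr0 addr0 normr0 powR0 ?mulr0//.
  have p1' : (1 <= p%:E)%E by rewrite lee_fin.
  have usv : u.1 \_ Omega + s *: (v.1 \_ Omega) \in Lfun (leb N) p%:E.
    rewrite addrC; exact: (Lfun_submod_closed (leb N) p1').2.
  have := @integrableZl _ _ _ (leb N) _ measurableT p^-1 _ (Lfun_integrable p_ge1 usv).
  by congr (integrable _ _ _); apply/funext => x /=; rewrite -EFinM.
rewrite /F1 mul0r add0r; congr (_ * _); rewrite intOE.
apply: eq_Rintegral => x _; rewrite !patchE; case: ifP => _.
  by rewrite mul0r addr0.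
by rewrite !mulr0.
Qed.

End functionals.

(** * Normalization of curves *)

Section constrained_curves.
Context {R : realType} {N : nat}.
Variables (Omega : set 'rV[R]_N) (mu : R) (u : sobolev R N).
Hypotheses (mu_gt0 : 0 < mu) (uM : mass_manifold Omega mu u).
Implicit Types (gamma : R -> sobolev R N).

Local Notation dotL2 := (dotL2 Omega).
Local Notation dotH1 := (dotH1 Omega).
Local Notation M := (mass_manifold Omega mu).
Local Notation C2curve := (C2curve (H10 Omega) dotH1).

Lemma mass_H10 : H10 Omega u. Proof. by have [] := (mass_manifoldE _ _ _).1 uM. Qed.
Lemma mass_dotL2 : dotL2 u u = 2 * mu. Proof. by have [] := (mass_manifoldE _ _ _).1 uM. Qed.

Let SB0 : semi_inner (H10 Omega) dotL2. Proof. by have [] := H10_semi_inner mass_H10. Qed.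
Let SB : semi_inner (H10 Omega) dotH1. Proof. by have [] := H10_semi_inner mass_H10. Qed.

Lemma C2_curveE e gamma gamma1 gamma2 :
  C2_curve Omega e gamma gamma1 gamma2 = C2curve e gamma gamma1 gamma2.
Proof. by rewrite /C2_curve normH1_snorm. Qed.

(** With n = |gamma|_2^2 / (2 mu), which is 1 at t = 0, the factor
    rho = n^(-1/2) brings the curve onto the mass manifold. It adds the multiple
    rho'(0) u to the velocity, and rho'(0) depends on the velocity only. *)
Lemma normalized_curve e gamma gamma1 gamma2 : 0 < e ->
  C2curve e gamma gamma1 gamma2 -> gamma 0 = u ->
  exists e' rho rho1 rho2, [/\ 0 < e' /\ e' <= e, C2on e' rho rho1 rho2,
    rho 0 = 1 /\ rho1 0 = - (dotL2 u (gamma1 0) / (2 * mu)),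
    forall t, `|t| < e' -> 0 < rho t /\ rho t ^+ 2 * dotL2 (gamma t) (gamma t) = 2 * mu &
    curve_through Omega M u (rho1 0 *: u + gamma1 0) (fun t => rho t *: gamma t)].
Proof.
move=> e0 gC g0.
have nC := C2onM (@C2on_cst R e (2 * mu)^-1) (C2curve_inner SB SB0 (@dotL2_le_dotH1 _ _ Omega) gC).
set n := (X in C2on _ X _ _) in nC.
have mu2 : 2 * mu != 0 by rewrite gt_eqF// mulr_gt0.
have n0 : n 0 = 1 by rewrite /n g0 mass_dotL2 mulVf.
have [|e' [e'0 ee n_gt0]] := C2on_gt0 e0 nC; first by rewrite n0.
have rC := C2on_powR (- 2^-1) n_gt0 (C2on_le ee nC).
set rho := (X in C2on _ X _ _) in rC; set rho1 := (X in C2on _ _ X _) in rC.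
set rho2 := (X in C2on _ _ _ X) in rC.
have rho0 : rho 0 = 1 by rewrite /rho n0 powR1.
have rho10 : rho1 0 = - (dotL2 u (gamma1 0) / (2 * mu)).
  by rewrite /rho1 n0 powR1 g0 /=; field; rewrite gt_eqF.
have rho_mass t : `|t| < e' -> 0 < rho t /\ rho t ^+ 2 * dotL2 (gamma t) (gamma t) = 2 * mu.
  move=> te; have nt := n_gt0 t te; split; first exact: powR_gt0.
  rewrite -powR_mulrn ?powR_ge0// -powRrM mulNr mulVf ?pnatr_eq0//.
  rewrite powR_inv1 ?ltW//; move: nt; rewrite /n /=.
  set d := dotL2 _ _ => nt; have d0 : d != 0.
    by apply: contraTneq nt => ->; rewrite mulr0 ltxx.
  by field; rewrite d0 gt_eqF.
exists e', rho, rho1, rho2; split => //.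
have gC' := C2curve_le ee gC.
eexists; eexists; eexists; split; [exact: e'0| | | |].
- by rewrite C2_curveE; exact: (C2curveZ SB rC gC').
- move=> t te; apply/mass_manifoldE; have [[Sg _ _] _ _ _] := gC' t te.
  split; first exact: (subspaceZ SB).
  by rewrite (inner_sqrZ SB0 _ Sg); have [] := rho_mass t te.
- by rewrite rho0 scale1r.
- by rewrite /= rho0 scale1r g0.
Qed.

End constrained_curves.

(** * Local minimality *)

Section local_minima.
Context {R : realType} {N : nat}.
Variables (Omega : set 'rV[R]_N) (p lambda mu : R) (u : sobolev R N).
Hypotheses (p2 : 2 < p) (mu_gt0 : 0 < mu) (uM : mass_manifold Omega mu u).
Implicit Types (v w : sobolev R N).

Local Notation dotL2 := (dotL2 Omega).
Local Notation dotgrad := (dotgrad Omega).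
Local Notation dotH1 := (dotH1 Omega).
Local Notation dotJ := (dotJ Omega lambda).
Local Notation P := (powR_integral Omega p).
Local Notation M := (mass_manifold Omega mu).
Local Notation NN := (nehari Omega p lambda).

Let p_gt0 : 0 < p. Proof. exact: lt_trans p2. Qed.
Let p_neq0 : p != 0. Proof. by rewrite gt_eqF. Qed.
Let p_ge1 : 1 <= p. Proof. by rewrite ltW// (lt_trans _ p2)// ltr1n. Qed.
Let uH := mass_H10 uM.
Let u0 := mass_dotL2 uM.

Let SB0 : semi_inner (H10 Omega) dotL2. Proof. by have [] := H10_semi_inner uH. Qed.
Let SB1 : semi_inner (H10 Omega) dotgrad. Proof. by have [] := H10_semi_inner uH. Qed.
Let SB : semi_inner (H10 Omega) dotH1. Proof. by have [] := H10_semi_inner uH. Qed.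

Lemma snorm_dotL2_le v : snorm dotL2 v <= snorm dotH1 v.
Proof. by rewrite ler_wsqrtr// dotL2_le_dotH1. Qed.

Lemma snorm_dotgrad_le v : snorm dotgrad v <= snorm dotH1 v.
Proof. by rewrite ler_wsqrtr// dotgrad_le_dotH1. Qed.

(** The factor is c = |u|_2 / |w|_2, which tends to 1 as w tends to u. *)
Lemma normalize_near (r : R) : 0 < r -> exists2 d : R, 0 < d &
  forall w, H10 Omega w -> normH1 Omega (w - u) < d ->
    exists c : R, [/\ 0 < c, M (c *: w) & normH1 Omega (c *: w - u) < r].
Proof.
move=> r0; rewrite normH1_snorm.
pose m := snorm dotL2 u; pose K := snorm dotH1 u.
have m0 : 0 < m by rewrite sqrtr_gt0 u0 mulr_gt0.
have K0 : 0 <= K by exact: snorm_ge0.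
pose d := Num.min (m / 2) (r / (4 * (1 + K / m))).
have dK0 : 0 < 4 * (1 + K / m) by rewrite mulr_gt0// ltr_pwDl// divr_ge0// ltW.
have d0 : 0 < d by rewrite lt_min !divr_gt0.
have dm : d <= m / 2 by rewrite ge_min lexx.
have dr : 2 * (d * (1 + K / m)) <= r / 2.
  have : d <= r / (4 * (1 + K / m)) by rewrite ge_min lexx orbT.
  by rewrite ler_pdivlMr// => h; lra.
exists d => // w wH wd.
have wuH := subspaceB SB wH uH; have uwH := subspaceB SB uH wH.
have wd0 : snorm dotL2 (w - u) < d by rewrite (le_lt_trans (snorm_dotL2_le _)).
set s := snorm dotL2 w.
have h1 : m <= d + s.
  rewrite /m -(subrK w u) (le_trans (snormD SB0 uwH wH))// lerD2r.
  by rewrite (snormB SB0)// ltW.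
have h2 : s <= d + m.
  by rewrite /s -(subrK u w) (le_trans (snormD SB0 wuH uH))// lerD2r ltW.
have s0 : m / 2 <= s by lra.
have s_gt0 : 0 < s by rewrite (lt_le_trans _ s0)// divr_gt0.
have c0 : 0 < m / s by rewrite divr_gt0.
have E : (m / s) *: w - u = (m / s) *: (w - u) + (m / s - 1) *: u.
  by rewrite scalerBr scalerBl scale1r addrA subrK.
exists (m / s); split; first exact: c0.
  apply/mass_manifoldE; split; first exact: (subspaceZ SB).
  rewrite (inner_sqrZ SB0 _ wH) -(snorm_sqr SB0 w) -/s -u0 -(snorm_sqr SB0 u) -/m.
  by field; exact: lt0r_neq0.
rewrite E; apply: le_lt_trans (snorm_combination SB _ _ wuH uH) _.
have c2 : m / s <= 2 by rewrite ler_pdivrMr//; lra.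
have c1 : `|m / s - 1| <= 2 * d / m.
  have -> : m / s - 1 = (m - s) / s by field; exact: lt0r_neq0.
  rewrite normrM normfV (gtr0_norm s_gt0) ler_pdivrMr//.
  have -> : 2 * d / m * s = d * (s / (m / 2)) by field; exact: lt0r_neq0.
  have : 1 <= s / (m / 2) by rewrite ler_pdivlMr ?mul1r// divr_gt0.
  by rewrite ler_norml => h; apply/andP; split; nra.
rewrite (gtr0_norm c0) -/K.
apply: (@le_lt_trans _ _ (2 * d + 2 * d / m * K)).
  by apply: lerD; apply: ler_pM => //; rewrite ?snorm_ge0// ltW.
have -> : 2 * d + 2 * d / m * K = 2 * (d * (1 + K / m)) by field; exact: lt0r_neq0.
lra.
Qed.

(** Young's inequality for c^2 and 1 with the exponents p / 2 and p / (p - 2):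
    the function c |-> c^2 / 2 - c^p / p is maximal at 1. *)
Lemma fiber_max (c : R) : 0 < c -> c ^+ 2 / 2 - c `^ p / p <= 1 / 2 - 1 / p.
Proof.
move=> c0; have c20 : 0 <= c ^+ 2 by exact: sqr_ge0.
have cp : (c ^+ 2) `^ (p / 2) = c `^ p.
  by rewrite -powR_mulrn ?ltW// -powRrM; congr (_ `^ _); field.
have E : (p / 2)^-1 + (p / (p - 2))^-1 = 1.
  by field; rewrite p_neq0 subr_eq0 gt_eqF.
have := @conjugate_powR R (c ^+ 2) 1 (p / 2) (p / (p - 2)) c20 ler01.
rewrite cp powR1 mulr1 !divr_gt0 ?subr_gt0// => /(_ isT isT E).
have -> : c `^ p / (p / 2) + 1 / (p / (p - 2)) = 2 * (c `^ p / p) + (1 - 2 * (1 / p)).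
  by field; rewrite p_neq0 subr_eq0 gt_eqF.
lra.
Qed.

Lemma action_energy w : action Omega p lambda w = energy Omega p w + lambda / 2 * dotL2 w w.
Proof. by rewrite (actionE _ _ p2) (energyE _ p2) /dotJ; field. Qed.

Lemma dotJZ (c : R) w : H10 Omega w -> dotJ (c *: w) (c *: w) = c ^+ 2 * dotJ w w.
Proof.
by move=> wH; rewrite /dotJ (inner_sqrZ SB0 _ wH) (inner_sqrZ SB1 _ wH); ring.
Qed.

(** On the Nehari manifold the action of c w is a positive multiple of
    c^2 / 2 - c^p / p. *)
Lemma action_scale_le (c : R) w : 0 < c -> NN w ->
  action Omega p lambda (c *: w) <= action Omega p lambda w.
Proof.
move=> c0 wN; have [wH _ AP] := (nehariE _ _ p2 _).1 wN; have [[w2 _ _] _] := wH.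
rewrite !(actionE _ _ p2) (dotJZ _ wH) (powR_integralZ p2 _ w2) (gtr0_norm c0) AP.
have -> : c ^+ 2 * P w / 2 - c `^ p * P w / p = (c ^+ 2 / 2 - c `^ p / p) * P w by field.
have -> : P w / 2 - P w / p = (1 / 2 - 1 / p) * P w by field.
by apply: ler_wpM2r; [exact: powR_integral_ge0|exact: fiber_max].
Qed.

(** For w on the Nehari manifold near u, let c w be its rescaling on the mass
    manifold, where J - E is constant: then J u <= J (c w) <= J w. *)
Lemma local_minimum_nehari : NN u -> local_minimum Omega M (energy Omega p) u ->
  local_minimum Omega NN (action Omega p lambda) u.
Proof.
move=> uN [_ [r r0 umin]]; split => //.
have [d d0 H] := normalize_near r0; exists d => // w wN wd.
have [wH _ _] := (nehariE _ _ p2 _).1 wN.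
have [c [c0 cM cr]] := H w wH wd.
apply: le_trans (action_scale_le c0 wN).
have [_ cw0] := (mass_manifoldE _ _ _).1 cM.
by rewrite !action_energy u0 cw0 lerD2r; exact: umin.
Qed.

(** Either |a| <= 2 |a - b|, which bounds a^2, or |a| <= 2 |b|, which bounds
    |a|^p. *)
Lemma min_sqr_powR_le (a b : R) :
  Num.min (a ^+ 2) (`|a| `^ p) <= 4 * ((a - b) * (a - b)) + 2 `^ p * `|b| `^ p.
Proof.
have pos1 : 0 <= (a - b) * (a - b) by rewrite -expr2 sqr_ge0.
have pos2 : 0 <= 2 `^ p * `|b| `^ p by rewrite mulr_ge0// powR_ge0.
have [h|h] := leP `|a| (2 * `|a - b|).
  rewrite ge_min; apply/orP; left.
  have : `|a| ^+ 2 <= (2 * `|a - b|) ^+ 2.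
    by rewrite ler_pXn2r// nnegrE// mulr_ge0.
  rewrite exprMn !real_normK ?num_real// => h2.
  by rewrite (le_trans h2)// expr2; lra.
rewrite ge_min; apply/orP; right.
rewrite (le_trans (_ : _ <= 2 `^ p * `|b| `^ p))//; last lra.
rewrite -powRM//; apply: ge0_ler_powR; rewrite ?nnegrE ?mulr_ge0//; first exact: ltW.
have := ler_normD (a - b) b; rewrite subrK; lra.
Qed.

(** If [P u] were 0, whether as an integral or by default, minimality would force
    the normalized test functions psi that approximate u to satisfy
    P psi / p <= |grad psi|_2^2 / 2 - |grad u|_2^2 / 2, which tends to 0. Then psi
    tends to u in L^2 and to 0 in L^p, so that u = 0. The two convergences are
    compared by integrating min(u^2, |u|^p). *)
Lemma energy_minimum_powR_integral_gt0 : local_minimum Omega M (energy Omega p) u -> 0 < P u.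
Proof.
move=> [_ [r0 r0_gt0 umin]]; rewrite lt_neqAle powR_integral_ge0 andbT eq_sym.
apply/eqP => Pu0; have [[u2 _ _] uapp] := uH.
have mu' := L2_measurable u2.
pose phi (a : R) := Num.min (a ^+ 2) (`|a| `^ p).
have p0 : `|0 : R| `^ p = 0 by rewrite normr0 powR0.
have phi0 : phi 0 = 0 by rewrite /phi expr0n/= p0 minxx.
have mphi : measurable_fun setT phi.
  apply: measurable_minr; first exact: measurable_funX.
  exact: measurable_norm_powR.
have phi_ge0 a : 0 <= phi a by rewrite le_min sqr_ge0 powR_ge0.
have iphi : integrableO Omega (phi \o u.1).
  apply: le_integrable (L2_mul_integrable u2 u2) => //.
    by rewrite restrict_comp0//; apply/measurable_EFinP; exact: measurableT_comp.
  move=> x _; rewrite lee_fin !patchE; case: ifP => // _.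
  by rewrite (ger0_norm (phi_ge0 _)) -expr2 ger0_norm ?sqr_ge0// ge_min lexx.
pose K := snorm dotgrad u.
have K0 : 0 <= K by exact: snorm_ge0.
have small r : 0 < r -> r <= r0 -> r <= 1 ->
    intO Omega (phi \o u.1) <= r * (4 + 2 `^ p * (p * (K + 1))).
  move=> r_gt0 rr0 r1.
  have [d d0 H] := normalize_near r_gt0.
  have [f [cf fd]] := uapp d d0.
  have fH := Cc_infty_H10 cf.
  have fd' : normH1 Omega ((f, gradient f) - u) < d.
    by move: fd; rewrite normH1_snorm (snormB SB).
  have [c [c0 cM cr]] := H _ fH fd'.
  set psi := c *: _ in cM cr.
  have psiH : H10 Omega psi by exact: (subspaceZ SB).
  have upH := subspaceB SB uH psiH; have puH := subspaceB SB psiH uH.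
  have := umin _ cM (lt_le_trans cr rr0).
  rewrite !(energyE _ p2) Pu0 mul0r subr0 => Eu.
  have cr' : snorm dotH1 (psi - u) < r by move: cr; rewrite normH1_snorm.
  have psi1 : snorm dotgrad psi <= r + K.
    rewrite -(subrK u psi) (le_trans (snormD SB1 puH uH))// lerD2r.
    by rewrite (le_trans (snorm_dotgrad_le _))// ltW.
  have psi1' : dotgrad psi psi <= (r + K) ^+ 2.
    by rewrite -(snorm_sqr SB1) ler_pXn2r// nnegrE ?snorm_ge0// addr_ge0// ltW.
  have u1 : dotgrad u u = K ^+ 2 by rewrite (snorm_sqr SB1).
  have Ppsi : P psi <= p * (r * (K + 1)).
    have -> : P psi = p * (P psi / p) by field.
    apply: ler_wpM2l; first exact: ltW.
    move: Eu psi1'; rewrite u1; clear -r_gt0 r1 K0.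
    by move: (dotgrad psi psi) (P psi / p) => D Q Eu psi1'; nra.
  have up0 : dotL2 (u - psi) (u - psi) <= r.
    rewrite -(snorm_sqr SB0) (snormB SB0)//.
    have h : snorm dotL2 (psi - u) < r by rewrite (le_lt_trans (snorm_dotL2_le _)).
    have h0 := snorm_ge0 dotL2 (psi - u).
    by rewrite expr2 (le_trans (ler_pM h0 h0 (ltW h) (ltW h)))// ler_piMl// ltW.
  have [[psi2 _ _] _] := psiH; have [[ups2 _ _] _] := upH.
  have ipsi : integrableO Omega (fun x => `|psi.1 x| `^ p).
    have := cube_supported_norm_powR p_gt0 (Cc_infty_cube_supported cf).1.
    move=> /(@integrableZl _ _ _ (leb N) _ measurableT (`|c| `^ p)).
    congr (integrable _ _ _); apply/funext => x.
    rewrite /comp -[in LHS](Cc_infty_restrict cf) !patchE.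
    case: ifP => _; last by rewrite p0 mule0.
    by rewrite -EFinM -powRM// -normrM.
  have isq := L2_mul_integrable ups2 ups2.
  have IZ1 := integrableOZ 4 isq; have IZ2 := integrableOZ (2 `^ p) ipsi.
  apply: le_trans (le_intO iphi (integrableOD IZ1 IZ2)
    (fun x => min_sqr_powR_le (u.1 x) (psi.1 x))) _.
  rewrite intOD// intOZ// intOZ// -/(dotL2 _ _) -/(P psi).
  have t0 : 0 <= 2 `^ p :> R by exact: powR_ge0.
  rewrite mulrDr; apply: lerD; first by rewrite mulrC; apply: ler_wpM2r.
  rewrite mulrCA; apply: ler_wpM2l; first exact: t0.
  by rewrite [leRHS]mulrCA.
have int0 : intO Omega (phi \o u.1) = 0.
  apply/eqP; rewrite eq_le; apply/andP; split; last by apply: intO_ge0 => x; exact: phi_ge0.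
  pose C := 4 + 2 `^ p * (p * (K + 1)).
  have C0 : 0 < C.
    by rewrite ltr_wpDr// mulr_ge0 ?powR_ge0// mulr_ge0 ?addr_ge0// ltW.
  rewrite leNgt; apply/negP => I0.
  pose I := intO Omega (phi \o u.1).
  pose r := Num.min (Num.min r0 1) (I / (2 * C)).
  have := small r; rewrite !lt_min r0_gt0 ltr01 divr_gt0 ?mulr_gt0//=.
  rewrite !ge_min !lexx !orbT /= => /(_ isT isT isT).
  apply/negP; rewrite -ltNge -/C -/I.
  rewrite (@le_lt_trans _ _ (I / (2 * C) * C))//.
    by rewrite ler_wpM2r ?ge_min ?lexx ?orbT// ltW.
  have -> : I / (2 * C) * C = I / 2 by field; exact: lt0r_neq0.
  by rewrite ltr_pdivrMr//; move: I0; rewrite -/I => I0; lra.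
have : null Omega u.1.
  apply: (intO_eq0_null phi0 mphi _ mu' iphi int0) => x x0.
  rewrite lt_min; apply/andP; split; first by rewrite exprn_even_gt0.
  by apply: powR_gt0; rewrite normr_gt0.
move=> /(dotL2_null u2); rewrite u0 => /eqP; apply/negP.
by rewrite gt_eqF// mulr_gt0.
Qed.

End local_minima.

(** * Second derivatives *)

Section nondegeneracy.
Context {R : realType} {N : nat}.
Variables (Omega : set 'rV[R]_N) (p lambda mu : R) (u : sobolev R N).
Hypotheses (p2 : 2 < p) (mu_gt0 : 0 < mu).
Implicit Types (v w : sobolev R N) (gamma : R -> sobolev R N).

Local Notation dotL2 := (dotL2 Omega).
Local Notation dotgrad := (dotgrad Omega).
Local Notation dotH1 := (dotH1 Omega).
Local Notation dotJ := (dotJ Omega lambda).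
Local Notation P := (powR_integral Omega p).
Local Notation M := (mass_manifold Omega mu).
Local Notation NN := (nehari Omega p lambda).
Local Notation E := (energy Omega p).
Local Notation J := (action Omega p lambda).
Local Notation TM := (tangent_mass Omega u).
Local Notation TN := (tangent_nehari Omega p u).
Local Notation C2curve := (C2curve (H10 Omega) dotH1).

Hypothesis u_min : nondegenerate_local_minimum Omega M TM E u.
Hypothesis u_weak : weak_solution Omega p lambda u.

Let p_gt0 : 0 < p. Proof. exact: lt_trans p2. Qed.
Let p_ge1 : 1 <= p. Proof. by rewrite ltW// (lt_trans _ p2)// ltr1n. Qed.
Let p_neq0 : p != 0. Proof. by rewrite gt_eqF. Qed.
Let mu2 : 2 * mu != 0. Proof. by rewrite gt_eqF// mulr_gt0. Qed.
Let uM : M u. Proof. by have [[]] := u_min. Qed.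
Let uH := mass_H10 uM.
Let u0 := mass_dotL2 uM.
Let u_L2 : L2 Omega u.1. Proof. by have [[]] := uH. Qed.

Let SB0 : semi_inner (H10 Omega) dotL2. Proof. by have [] := H10_semi_inner uH. Qed.
Let SB1 : semi_inner (H10 Omega) dotgrad. Proof. by have [] := H10_semi_inner uH. Qed.
Let SB : semi_inner (H10 Omega) dotH1. Proof. by have [] := H10_semi_inner uH. Qed.

Lemma powR_integral_u_gt0 : 0 < P u.
Proof. by apply: (energy_minimum_powR_integral_gt0 p2 mu_gt0 uM); have [] := u_min. Qed.

Lemma weak_solution_dotJ w : H10 Omega w ->
  dotJ u w = intO Omega (fun x => `|u.1 x| `^ (p - 2) * u.1 x * w.1 x).
Proof. by move=> wH; rewrite -u_weak. Qed.

Lemma dotJ_u : dotJ u u = P u.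
Proof.
rewrite weak_solution_dotJ//; apply: eq_intO => x.
by rewrite -mulrA -expr2 -norm_powRD2 ?subr_gt0// subrK.
Qed.

Lemma nonzeroE w : H10 Omega w -> nonzero Omega w <-> dotL2 w w != 0.
Proof.
move=> [[w2 _ _] _]; split.
  by move=> h; apply/eqP => /(dotL2_eq0_null w2).
by move=> h /(dotL2_null w2) E0; move: h; rewrite E0 eqxx.
Qed.

Lemma nehari_u : NN u.
Proof.
apply/(nehariE _ _ p2); split => //; last exact: dotJ_u.
by apply/(nonzeroE uH); rewrite u0.
Qed.

Local Notation sdE := (second_derivative Omega M E u).

(** A positive infimum excludes the default value 0 of [second_derivative], so
    it also tells that the energy is twice differentiable along every curve of
    the mass manifold with the given velocity. *)
Lemma energy_second_derivative : exists2 c : R, 0 < c &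
  forall w, TM w -> nonzero Omega w -> c * dotL2 w w <= sdE w /\
    forall gamma, curve_through Omega M u w gamma ->
      has_derive2 (E \o gamma) 0 (sdE w).
Proof.
have [_ infpos] := u_min.
have [c c0 Hc] : exists2 c : R, 0 < c & forall w, TM w -> nonzero Omega w ->
    c * dotL2 w w <= sdE w.
  move: infpos; set X := (X in ereal_inf X) => infpos.
  have [c c0 cX] : exists2 c : R, 0 < c & forall x, X x -> (c%:E <= x)%E.
    case Ei : (ereal_inf X) infpos => [r||]//.
      rewrite lte_fin => r0; exists r => // x Xx.
      by rewrite -Ei; exact: ereal_inf_lbound.
    move=> _; exists 1 => // x Xx.
    by rewrite (le_trans _ (ereal_inf_lbound Xx))// Ei leey.
  exists c => // w wT wnz; have [wH _] := wT.
  have w0 : 0 < dotL2 w w by rewrite lt_neqAle dotL2_ge0 eq_sym andbT; apply/(nonzeroE wH).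
  have : X (sdE w / normL Omega 2 w.1 ^+ 2)%:E by exists w.
  by move=> /cX; rewrite lee_fin normL2E ler_pdivlMr.
exists c => // w wT wnz; split; first exact: Hc.
have : 0 < sdE w.
  rewrite (lt_le_trans _ (Hc w wT wnz))// mulr_gt0//.
  by rewrite lt_neqAle dotL2_ge0 eq_sym andbT; apply/(nonzeroE wT.1).
rewrite /second_derivative; case: xgetP => [d _ [_ Hd] _|]; first exact: Hd.
by rewrite ltxx.
Qed.

(** The L^2-orthogonal projection of [v] on the complement of [u], which is the
    tangent space of the mass manifold. *)
Definition mass_part v := - (dotL2 u v / (2 * mu)) *: u + v.

Lemma mass_part_H10 v : H10 Omega v -> H10 Omega (mass_part v).
Proof. by move=> vH; exact: H10_linear. Qed.

Lemma tangent_mass_part v : H10 Omega v -> TM (mass_part v).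
Proof.
move=> vH; split; first exact: mass_part_H10.
change (dotL2 u (mass_part v) = 0); have auH := subspaceZ SB (- (dotL2 u v / (2 * mu))) uH.
rewrite (innerDr SB0 auH vH uH) (innerZr SB0 _ uH uH) u0.
by field; rewrite gt_eqF.
Qed.

(** Along the normalization of u + t w the energy has a derivative at t = 0, so
    it is continuous there, and therefore so is P (u + t w). As P u > 0, the
    value P (u + t w) is positive for some t <> 0, which puts u + t w, hence w, in
    L^p. *)
Lemma Lfun_mass_part w : TM w -> nonzero Omega w -> w.1 \_ Omega \in Lfun (leb N) p%:E.
Proof.
move=> wT wnz; have [wH uw0] := wT; have {}uw0 : dotL2 u w = 0 by exact: uw0.
have [c c0 /(_ w wT wnz)[_ Hw]] := energy_second_derivative.
pose l (t : R) : sobolev R N := u + t *: w.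
have lC (e : R) : C2curve e l (cst w) (cst 0) by exact: C2curve_line.
have l0 : l 0 = u by rewrite /l scale0r addr0.
have [e' [rho [rho1 [rho2 [[e'0 _] rC [rho0 rho10] rhoM cT]]]]] :=
  normalized_curve mu_gt0 uM ltr01 (lC 1) l0.
rewrite rho10 uw0 mul0r oppr0 scale0r add0r in cT.
have dC := C2curve_inner SB SB1 (@dotgrad_le_dotH1 _ _ Omega) (lC e').
have z0 : `|0 : R| < e' by rewrite normr0.
have [cd _] := C2on_continuous dC z0; have [cr _] := C2on_continuous rC z0.
have [nd _] := Hw _ cT.
have cE : {for 0, continuous (E \o (fun t => rho t *: l t))}.
  apply: differentiable_continuous; apply/derivable1_diffP.
  exact: nbhs_singleton nd.
have rpos t : `|t| < e' -> 0 < rho t by move=> /rhoM[].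
have rpC := C2on_powR (- p) rpos rC.
have [crp _] := C2on_continuous rpC z0.
have lH t : H10 Omega (l t) := subspaceD SB uH (subspaceZ SB t wH).
have lL2 t : L2 Omega (l t).1 by have [[]] := lH t.
(* Solving the formula for the energy of rho (u + t w) for P (u + t w). *)
pose G t := p * (rho t `^ (- p) *
  (rho t ^+ 2 * dotgrad (l t) (l t) / 2 - (E \o (fun t => rho t *: l t)) t)).
have PG t : `|t| < e' -> P (l t) = G t.
  move=> te; have r0 := rpos t te; rewrite /G /= (energyE _ p2) (powR_integralZ p2 _ (lL2 t)).
  rewrite (gtr0_norm r0) (inner_sqrZ SB1 _ (lH t)).
  rewrite powRN; have rp : rho t `^ p != 0 by rewrite gt_eqF// powR_gt0.
  field; apply/andP; split; [exact: p_neq0|exact: rp].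
have cG : {for 0, continuous G}.
  apply: cvgM; first exact: cvg_cst; apply: cvgM => //; apply: cvgB => //.
  apply: cvgM; last exact: cvg_cst; apply: cvgM => //.
  by apply: (@continuousM _ _ rho rho).
have G0 : 0 < G 0 by rewrite -PG// l0 powR_integral_u_gt0.
have nearG : \forall t \near (0 : R), 0 < G t by move/cvgr_gt: cG; apply.
have near' : \forall t \near (0 : R)^', [/\ t != 0, `|t| < e' & 0 < G t].
  near=> t; split; [near: t; exact: nbhs_dnbhs_neq| |].
    by near: t; apply: nbhs_dnbhs; apply: near_ltr_norm; rewrite normr0.
  by near: t; exact: nbhs_dnbhs.
have [t [t0 te Gt]] := filter_ex near'.
rewrite -PG// in Gt.
have lt_p := powR_integral_gt0_Lfun p2 (lL2 t) Gt.
have u_p := powR_integral_gt0_Lfun p2 u_L2 powR_integral_u_gt0.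
have tw_p := Lfun_linear (- 1) p_ge1 u_p lt_p.
have -> : w.1 = (fun x => (t^-1 - 1) * (-1 * u.1 x + (l t).1 x) + (-1 * u.1 x + (l t).1 x)).
  apply/funext => x.
  by rewrite (_ : (l t).1 x = u.1 x + t * w.1 x)//; field.
exact: Lfun_linear.
Unshelve. all: by end_near. Qed.

(** If the part vanishes then v = a u, and tangency to the Nehari manifold reads
    a P u = 0. *)
Lemma nonzero_mass_part v : TN v -> nonzero Omega v -> nonzero Omega (mass_part v).
Proof.
move=> [vH uv0] vnz w_null; apply: vnz.
have [[v2 _ _] _] := vH; have [[w2 _ _] _] := mass_part_H10 vH.
pose a := dotL2 u v / (2 * mu).
have va : {ae leb N, forall x, Omega x -> v.1 x = a * u.1 x}.
  apply: filterS w_null => x wx Ox; apply/eqP; rewrite -subr_eq0; apply/eqP.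
  by rewrite -[RHS](wx Ox) /mass_part /a addrC; congr (_ + _); rewrite -mulNr.
have a0 : a = 0.
  apply/eqP; rewrite -[_ == _]negbK; apply/negP => a_neq0.
  have : a * P u = 0.
    have u_p := powR_integral_gt0_Lfun p2 u_L2 powR_integral_u_gt0.
    have iu : integrableO Omega (fun x => `|u.1 x| `^ p).
      rewrite /integrableO (restrict_comp0 _ _ (phi := fun y : R => `|y| `^ p)).
        exact: (Lfun_integrable p_ge1 u_p).
      by rewrite normr0 powR0.
    have mu' := L2_measurable u_L2; have mv' := L2_measurable v2.
    rewrite -{}uv0 -intOZ//; apply: intO_ae_eq.
    - rewrite (restrict_comp0 _ _ (phi := fun y : R => a * `|y| `^ p)) ?normr0 ?powR0 ?mulr0//.
      apply: (measurableT_comp _ mu'); apply: measurable_funM => //.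
      exact: measurable_norm_powR.
    - rewrite (_ : _ \_ _ = (fun x => `|(u.1 \_ Omega) x| `^ (p - 2) *
          (u.1 \_ Omega) x * (v.1 \_ Omega) x)).
        apply: measurable_funM => //; apply: measurable_funM => //.
        exact: (measurableT_comp (measurable_norm_powR _)).
      by apply/funext => x; rewrite !patchE; case: ifP; rewrite ?mulr0.
    - apply: filterS va => x vx Ox; rewrite vx//.
      have -> : `|u.1 x| `^ p = `|u.1 x| `^ (p - 2) * u.1 x ^+ 2.
        by rewrite -norm_powRD2 ?subr_gt0// subrK.
      by ring.
  by apply/eqP; rewrite mulf_neq0// gt_eqF// powR_integral_u_gt0.
by apply: filterS va => x vx Ox; rewrite vx// a0 mul0r.
Qed.

(** The ray through u + t v meets the Nehari manifold at s (u + t v) with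
    s^(p-2) = A (u + t v) / P (u + t v). The tangency condition says that the
    derivatives of A and P at t = 0 vanish, so that s'(0) = 0. *)
Lemma nehari_curve_exists v : TN v -> v.1 \_ Omega \in Lfun (leb N) p%:E ->
  exists gamma, curve_through Omega NN u v gamma.
Proof.
move=> [vH uv0] v_p.
have u_p := powR_integral_gt0_Lfun p2 u_L2 powR_integral_u_gt0.
have Auv : dotJ u v = 0 by rewrite weak_solution_dotJ.
pose l (t : R) : sobolev R N := u + t *: v.
have lC (e : R) : C2curve e l (cst v) (cst 0) by exact: C2curve_line.
have l0 : l 0 = u by rewrite /l scale0r addr0.
have lH t : H10 Omega (l t) := subspaceD SB uH (subspaceZ SB t vH).
have aC := C2onD (C2curve_inner SB SB1 (@dotgrad_le_dotH1 _ _ Omega) (lC 1))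
  (C2onM (@C2on_cst R 1 lambda) (C2curve_inner SB SB0 (@dotL2_le_dotH1 _ _ Omega) (lC 1))).
set a := (X in C2on _ X _ _) in aC; set a1 := (X in C2on _ _ X _) in aC.
have [b1 [b2 [bC b10]]] := powR_integral_line p2 1 u_p v_p.
have a0 : a 0 = P u by rewrite /a l0 -dotJ_u.
have a10 : a1 0 = 0.
  by rewrite /a1 l0 mul0r add0r mulrCA -mulrDr -/(dotJ u v) Auv mulr0.
have b0 : P (u + 0 *: v) = P u by rewrite scale0r addr0.
have Pu := powR_integral_u_gt0.
have [|ea [ea0 ea1 a_gt0]] := C2on_gt0 ltr01 aC; first by rewrite a0.
have [|eb [eb0 eb1 b_gt0]] := C2on_gt0 ltr01 bC; first by rewrite b0.
pose e := Num.min ea eb.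
have e0 : 0 < e by rewrite lt_min ea0.
have eA : e <= ea by rewrite ge_min lexx.
have eB : e <= eb by rewrite ge_min lexx orbT.
have {}a_gt0 t : `|t| < e -> 0 < a t by move=> te; apply: a_gt0; exact: lt_le_trans eA.
have {}b_gt0 t : `|t| < e -> 0 < P (l t) by move=> te; apply: b_gt0; exact: lt_le_trans eB.
have {}aC := C2on_le (le_trans eA ea1) aC.
have {}bC := C2on_le (le_trans eB eb1) bC.
have qC := C2onM aC (C2on_powR (- 1) b_gt0 bC).
have q_gt0 t : `|t| < e -> 0 < a t * P (l t) `^ (-1).
  by move=> te; exact: (mulr_gt0 (a_gt0 t te) (powR_gt0 _ (b_gt0 t te))).
have sC := C2on_powR (p - 2)^-1 q_gt0 qC.
set s := (X in C2on _ X _ _) in sC; set s1 := (X in C2on _ _ X _) in sC.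
have Pu1 : P u * P u `^ (-1) = 1.
  by rewrite (powR_inv1 (ltW Pu)) divff// (gt_eqF Pu).
have s0 : s 0 = 1 by rewrite /s a0 b0 Pu1 powR1.
have s10 : s1 0 = 0.
  by rewrite /s1 a10 b10 uv0 !mulr0 mul0r addr0 mulr0.
exists (fun t => s t *: l t); do 3 eexists; split; [exact: e0| | | |].
- by rewrite C2_curveE; exact: (C2curveZ SB sC (lC e)).
- move=> t te; have stH : H10 Omega (s t *: l t) := subspaceZ SB (s t) (lH t).
  have at_gt0 := a_gt0 t te; have bt_gt0 := b_gt0 t te; have qt_gt0 := q_gt0 t te.
  have st : 0 < s t := powR_gt0 _ qt_gt0.
  have [[lt2 _ _] _] := lH t; have [[stl2 _ _] _] := stH.
  have PE : P (s t *: l t) = s t `^ p * P (l t).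
    by rewrite (powR_integralZ p2 _ lt2) (gtr0_norm st).
  have AE : dotJ (s t *: l t) (s t *: l t) = s t ^+ 2 * a t := dotJZ _ uM (s t) (lH t).
  have Pst : 0 < P (s t *: l t) by rewrite PE (mulr_gt0 (powR_gt0 _ st) bt_gt0).
  have q0 : 0 < p - 2 by rewrite subr_gt0.
  have sp : s t `^ p = s t ^+ 2 * (a t / P (l t)).
    have := norm_powRD2 (s t) q0; rewrite (gtr0_norm st) subrK => ->.
    rewrite mulrC {2}/s -powRrM mulVf ?gt_eqF// (powRr1 (ltW qt_gt0)).
    by rewrite (powR_inv1 (ltW bt_gt0)).
  apply/(nehariE _ _ p2); split; first exact: stH.
    by move=> /(powR_integral_null p2 stl2) Z; move: Pst; rewrite Z ltxx.
  by rewrite AE PE sp -mulrA divfK// (gt_eqF bt_gt0).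
- by rewrite s0 scale1r l0.
- by rewrite /= s10 s0 scale0r add0r scale1r.
Qed.

(** Let gamma be a curve of the Nehari manifold, so that J gamma =
    (1/2 - 1/p) A gamma, and let rho gamma be its normalization, so that
    E (rho gamma) + lambda mu = (rho^2 / 2 - rho^p / p) A gamma. The factor has
    the first derivative 0 and the second derivative (2 - p) rho'(0)^2 at
    t = 0, where rho = 1; hence the two second derivatives differ by
    (2 - p) rho'(0)^2 A u, and rho'(0) = - <u, v> / (2 mu). *)
Lemma nehari_second_derivative v gamma : H10 Omega v -> nonzero Omega (mass_part v) ->
  curve_through Omega NN u v gamma ->
  has_derive2 (J \o gamma) 0
    (sdE (mass_part v) + (p - 2) * (dotL2 u v / (2 * mu)) ^+ 2 * P u).
Proof.
move=> vH wnz [e [gamma1 [gamma2 [e0 gC gN g0 g1]]]]; rewrite C2_curveE in gC.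
have [e' [rho [rho1 [rho2 [[e'0 ee] rC [rho0 rho10] rhoM cT]]]]] :=
  normalized_curve mu_gt0 uM e0 gC g0.
rewrite rho10 g1 -/(mass_part v) in cT.
have [c c0 /(_ _ (tangent_mass_part vH) wnz)[_ /(_ _ cT) Ew]] := energy_second_derivative.
have gC' := C2curve_le ee gC.
have aC := C2onD (C2curve_inner SB SB1 (@dotgrad_le_dotH1 _ _ Omega) gC')
  (C2onM (@C2on_cst R e' lambda) (C2curve_inner SB SB0 (@dotL2_le_dotH1 _ _ Omega) gC')).
set a := (X in C2on _ X _ _) in aC; set a1 := (X in C2on _ _ X _) in aC.
set a2 := (X in C2on _ _ _ X) in aC.
have a0 : a 0 = P u by rewrite /a g0 -dotJ_u.
have gN' t : `|t| < e' -> [/\ H10 Omega (gamma t), nonzero Omega (gamma t) &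
    dotJ (gamma t) (gamma t) = P (gamma t)].
  by move=> te; apply/(nehariE _ _ p2)/gN; exact: lt_le_trans ee.
have JE t : `|t| < e' -> (1 / 2 - 1 / p) * a t = (J \o gamma) t.
  move=> te; have [_ _ AP] := gN' t te.
  by rewrite /= (actionE _ _ p2) -AP /a -/(dotJ _ _); field.
have JC := C2on_eq JE (C2onM (@C2on_cst R e' (1 / 2 - 1 / p)) aC).
have rpos t : `|t| < e' -> 0 < rho t by move=> /rhoM[].
have kC := C2onD (C2onM (@C2on_cst R e' 2^-1) (C2onM rC rC))
  (C2onM (@C2on_cst R e' (- p^-1)) (C2on_powR p rpos rC)).
have EE t : `|t| < e' ->
    (2^-1 * (rho t * rho t) + - p^-1 * rho t `^ p) * a t + - (lambda * mu)
    = (E \o (fun t => rho t *: gamma t)) t.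
  move=> te; have [gH _ AP] := gN' t te; have [r0 rm] := rhoM t te.
  have [[g2 _ _] _] := gH.
  rewrite /= (energyE _ p2) (powR_integralZ p2 _ g2) (gtr0_norm r0) (inner_sqrZ SB1 _ gH).
  rewrite -AP /a -/(dotJ _ _).
  have -> : dotgrad (gamma t) (gamma t) =
      dotJ (gamma t) (gamma t) - lambda * dotL2 (gamma t) (gamma t).
    by rewrite /dotJ addrK.
  have -> : mu = rho t ^+ 2 * dotL2 (gamma t) (gamma t) / 2 by rewrite rm; field.
  by field.
have EC := C2on_eq EE (C2onD (C2onM kC aC) (@C2on_cst R e' (- (lambda * mu)))).
have JD := C2on_derive2 e'0 JC; have ED := C2on_derive2 e'0 EC.
have Eq := has_derive2_unique ED Ew.
move: JD; congr (has_derive2 _ _ _); rewrite -Eq /=.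
rewrite rho0 !powR1 rho10 a0 g1.
by field; rewrite p_neq0 gt_eqF.
Qed.

Local Notation sdJ := (second_derivative Omega NN J u).

Lemma Lfun_tangent_nehari v : TN v -> nonzero Omega v -> v.1 \_ Omega \in Lfun (leb N) p%:E.
Proof.
move=> vT vnz; have [vH _] := vT.
have w_p := Lfun_mass_part (tangent_mass_part vH) (nonzero_mass_part vT vnz).
have u_p := powR_integral_gt0_Lfun p2 u_L2 powR_integral_u_gt0.
have -> : v.1 = (fun x => dotL2 u v / (2 * mu) * u.1 x + (mass_part v).1 x).
  apply/funext => x.
  by rewrite (_ : (mass_part v).1 x = - (dotL2 u v / (2 * mu)) * u.1 x + v.1 x)//; ring.
exact: Lfun_linear.
Qed.

Lemma dotL2_mass_part v : H10 Omega v ->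
  dotL2 v v = dotL2 (mass_part v) (mass_part v) + (dotL2 u v / (2 * mu)) ^+ 2 * (2 * mu).
Proof.
move=> vH; have auH := subspaceZ SB0 (- (dotL2 u v / (2 * mu))) uH.
rewrite /mass_part (inner_sqrD SB0)// (innerZl SB0)// (innerZr SB0)// (innerZl SB0)// u0.
by field; rewrite gt_eqF.
Qed.

Lemma action_second_derivative v : TN v -> nonzero Omega v ->
  sdJ v = sdE (mass_part v) + (p - 2) * (dotL2 u v / (2 * mu)) ^+ 2 * P u.
Proof.
move=> vT vnz; have [vH _] := vT; have wnz := nonzero_mass_part vT vnz.
have [gamma gT] := nehari_curve_exists vT (Lfun_tangent_nehari vT vnz).
rewrite /second_derivative; case: xgetP => [d _ [_ Hd]|/(_ (sdE (mass_part v) +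
    (p - 2) * (dotL2 u v / (2 * mu)) ^+ 2 * P u)) []].
  exact: has_derive2_unique (Hd _ gT) (nehari_second_derivative vH wnz gT).
by split; [exists gamma|move=> gamma'; exact: nehari_second_derivative].
Qed.

(** As v is the L^2-orthogonal sum of its tangent part w and of a multiple a u,
    one has |v|_2^2 = |w|_2^2 + 2 mu a^2, while the second derivative is at least
    c |w|_2^2 + (p - 2) a^2 P u. *)
Lemma nondegenerate_nehari : nondegenerate_local_minimum Omega NN TN J u.
Proof.
split.
  by apply: (local_minimum_nehari p2 mu_gt0 uM nehari_u); have [] := u_min.
have [c c0 Hc] := energy_second_derivative; have Pu := powR_integral_u_gt0.
pose c' := Num.min c ((p - 2) * P u / (2 * mu)).
have c'0 : 0 < c' by rewrite lt_min c0 divr_gt0 ?mulr_gt0 ?subr_gt0.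
rewrite (lt_le_trans (_ : 0 < c'%:E)%E) ?lte_fin//.
apply/ereal_infP => _ [v [vT vnz] <-].
have [vH _] := vT; have wnz := nonzero_mass_part vT vnz.
have [Hw _] := Hc _ (tangent_mass_part vH) wnz.
have v0 : 0 < dotL2 v v.
  by rewrite lt_neqAle dotL2_ge0 eq_sym andbT; apply/(nonzeroE vH).
rewrite lee_fin normL2E ler_pdivlMr// action_second_derivative// dotL2_mass_part//.
rewrite mulrDr lerD//.
  by rewrite (le_trans _ Hw)// ler_wpM2r ?dotL2_ge0// ge_min lexx.
have c'P : c' * (2 * mu) <= (p - 2) * P u.
  by rewrite -ler_pdivlMr ?mulr_gt0// ge_min lexx orbT.
set s := (_ / _) ^+ 2.
have -> : c' * (s * (2 * mu)) = s * (c' * (2 * mu)) by ring.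
have -> : (p - 2) * s * P u = s * ((p - 2) * P u) by ring.
by apply: ler_wpM2l => //; exact: sqr_ge0.
Qed.

End nondegeneracy.

Theorem theorem1p8 (R : realType) (N : nat) (Omega : set 'rV[R]_N)
    (p mu lambda : R) (u : sobolev R N) :
  (1 <= N)%N ->
  open Omega -> Omega !=set0 ->
  2 < p -> (p%:E < critical_exponent R N)%E ->
  0 < mu ->
  nondegenerate_local_minimum Omega
    (mass_manifold Omega mu) (tangent_mass Omega u) (energy Omega p) u ->
  weak_solution Omega p lambda u ->
  nondegenerate_local_minimum Omega
    (nehari Omega p lambda) (tangent_nehari Omega p u) (action Omega p lambda) u.
Proof. by move=> _ _ _ p2 _ mu_gt0; exact: nondegenerate_nehari. Qed.
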